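(* Consider the constant coefficients linearized plasma-vacuum problem (P) of the context (linearization about a planar interface) with $\varkappa=0$ and a constant state such that $$\hat v_1=\hat v_2=0,\quad \widehat H_1=\widehat H_2=0,\quad \widehat{\mathcal H}_1=\widehat{\mathcal H}_3=0,\quad \widehat E_2=\widehat E_3=0,\quad \widehat H_3\widehat{\mathcal H}_2\ne0 .$$ If $$\widehat E_1^2>\widehat{\mathcal H}_2^2,$$ then problem (P) is ill-posed: problem (P) with $F=0$ admits a nontrivial solution of the form $$U=\bar U\exp\{\tau t+\xi_{\rm p}x^1+i(\gamma',x')\},\quad V=\bar V\exp\{\tau t+\xi_{\rm v}x^1+i(\gamma',x')\},\quad \varphi=\bar\varphi\exp\{\tau t+i(\gamma',x')\}$$ with $\gamma'=(1,0)$, constant complex vectors $\bar U,\bar V$ and constant $\bar\varphi$, $(\bar U,\bar V)\neq0$, a real $\tau>0$, and $\Re\,\xi_{\rm p}<0$, $\Re\,\xi_{\rm v}<0$. (Consequently the sequence $(U(nt,nx),V(nt,nx),\varphi(nt,nx'))e^{-\sqrt n}$, $n=1,2,\dots$, is a Hadamard-type ill-posedness example.)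
   Context: **Notation.** $x=(x^1,x')$, $x'=(x^2,x^3)$, $x^1>0$. $(\ ,\ )$ is the scalar product, $e_j=(\delta_{1j},\delta_{2j},\delta_{3j})$, $(a\otimes b)_{ik}=a_ib_k$. **Plasma matrices.** $U=(p,u,H,S)\in\mathbb R^8$, $u,H\in\mathbb R^3$; a smooth equation of state gives the density $\rho=\rho(p,S)$ and internal energy $e$; $h=1+e+p/\rho$, $a^2=1/\rho_p(p,S)$, $c_s^2=a^2/h$, $\Gamma=\sqrt{1+|u|^2}$, $v=u/\Gamma$, $b=H/\Gamma+(u,H)v$, $B^2=|H|^2/\Gamma^2+(v,H)^2$. Symmetric matrices: $$A_0=\begin{pmatrix}\frac{\Gamma}{\rho a^2}&v^{\sf T}&0&0\\ v&\mathcal A&0&0\\0&0&\mathcal M&0\\0&0&0&1\end{pmatrix},\qquad A_j=\begin{pmatrix}\frac{u_j}{\rho a^2}&e_j^{\sf T}&0&0\\ e_j&\mathcal A_j&\mathcal N_j^{\sf T}&0\\0&\mathcal N_j&v_j\mathcal M&0\\0&0&0&v_j\end{pmatrix},$$ $$\mathcal A=\Bigl(\rho h\Gamma+\tfrac{|H|^2}{\Gamma}\Bigr)I-\Bigl(\rho h\Gamma+\tfrac{|H|^2+B^2}{\Gamma}\Bigr)v\otimes v-\tfrac1\Gamma H\otimes H+\tfrac{(v,H)}{\Gamma}(v\otimes H+H\otimes v),$$ $$\mathcal M=\tfrac1\Gamma(I+u\otimes u),\qquad \mathcal N_j=\tfrac1\Gamma b\otimes e_j-\tfrac{v_j}{\Gamma}b\otimes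 v-\tfrac{H_j}{\Gamma^2}I,$$ $$\mathcal A_j=v_j\Bigl\{\Bigl(\rho h\Gamma+\tfrac{|H|^2}{\Gamma}\Bigr)I-\Bigl(\rho h\Gamma+\tfrac{|H|^2-B^2}{\Gamma}\Bigr)v\otimes v-\tfrac1\Gamma H\otimes H\Bigr\}+\tfrac{H_j}{\Gamma}\Bigl\{\tfrac1{\Gamma^2}(v\otimes H+H\otimes v)-2(v,H)(I-v\otimes v)\Bigr\}+\tfrac{(v,H)}{\Gamma}(H\otimes e_j+e_j\otimes H)-\tfrac{B^2}{\Gamma}(v\otimes e_j+e_j\otimes v).$$ **Vacuum matrices.** $V=(\mathcal H,E)$; $B_1,B_2,B_3$ are the constant symmetric $6\times6$ matrices with $\sum_jB_j\partial_jV=(\nabla\times E,-\nabla\times\mathcal H)$. **Constant state.** $\widehat U=(\hat p,\hat u,\widehat H,\widehat S)$ and $\widehat V=(\widehat{\mathcal H},\widehat E)$ are constant vectors and $\varkappa$ is a constant, with $\hat v_1=\varkappa$, $\widehat H_1=\widehat{\mathcal H}_1=0$, $\widehat E_2=\varkappa\widehat{\mathcal H}_3$, $\widehat E_3=-\varkappa\widehat{\mathcal H}_2$; hatted quantities are computed from this state, and the hyperbolicity conditions $\hat\rho>0$, $\rho_p(\hat p,\widehat S)>0$, $0<\hat c_s^2<1$ are assumed ($|\hat v|<1$ automatically). **Problem (P)** for $U(t,x)$, $V(t,x)$, $\varphi(t,x')$: $$\widehat A_0\partial_tU+\sum_{j=1}^3\widehat A_j\partial_jU=F,\qquad \partial_tV-\widehat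 B_1\partial_1V+B_2\partial_2V+B_3\partial_3V=0\qquad\text{for }x^1>0,$$ where $\widehat A_\alpha=A_\alpha(\widehat U)$ ($\alpha=0,2,3$), $\widehat A_1=A_1(\widehat U)-\varkappa\widehat A_0$, $\widehat B_1=B_1-\varkappa I$, with boundary conditions at $x^1=0$ $$\partial_t\varphi=v_1-\hat v_2\partial_2\varphi-\hat v_3\partial_3\varphi,\qquad q=\widehat{\mathcal H}_2(\mathcal H_2+\varkappa E_3)+\widehat{\mathcal H}_3(\mathcal H_3-\varkappa E_2)-\widehat E_1E_1,$$ $$E_2=\widehat{\mathcal H}_3\partial_t\varphi-\widehat E_1\partial_2\varphi+\varkappa\mathcal H_3,\qquad E_3=-\widehat{\mathcal H}_2\partial_t\varphi-\widehat E_1\partial_3\varphi-\varkappa\mathcal H_2,$$ where $v=\frac1{\widehat\Gamma}(u-(\hat v,u)\hat v)$ and $q=p+\frac1{\widehat\Gamma}\bigl((\hat b,H)+(\hat v,\widehat H)(\widehat H,u)-\widehat B^2(\hat v,u)\bigr)$ are the perturbations of velocity and total pressure. In the exponential solutions the entropy component plays no role and may be taken to be $0$.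
   Formalization: In the Hadamard sequence the front component is taken as φ(nt,nx')e^{-√n}/n instead of φ(nt,nx')e^{-√n}, since without the factor 1/n the boundary conditions fail for n ≥ 2. *)

(* Defs.v *)
From HB Require Import structures.
From mathcomp Require Import all_boot all_order all_algebra.
From mathcomp Require Import complex.
From mathcomp Require Import all_classical all_reals all_analysis.

Set Implicit Arguments.
Unset Strict Implicit.
Unset Printing Implicit Defensive.

Import Order.TTheory GRing.Theory Num.Theory.
Import numFieldNormedType.Exports.

Local Open Scope classical_set_scope.
Local Open Scope complex_scope.
Local Open Scope ring_scope.

(** * Vectors and states *)

(* The components 1, 2, 3 are the ordinals ax1, ax2, ax3 of 'I_3. *)
Definition ax1 : 'I_3 := @Ordinal 3 0 isT.
Definition ax2 : 'I_3 := @Ordinal 3 1 isT.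
Definition ax3 : 'I_3 := @Ordinal 3 2 isT.

Definition basis3 (T : pzRingType) (j : 'I_3) : 'cV[T]_3 := delta_mx j 0.

Definition dot3 (T : pzRingType) (a b : 'cV[T]_3) : T :=
  \sum_(i < 3) a i 0 * b i 0.

Definition tens3 (T : pzRingType) (a b : 'cV[T]_3) : 'M[T]_3 :=
  \matrix_(i, k) (a i 0 * b k 0).

Definition cross3 (T : pzRingType) (a b : 'cV[T]_3) : 'cV[T]_3 :=
  \col_(i < 3) [:: a ax2 0 * b ax3 0 - a ax3 0 * b ax2 0;
                   a ax3 0 * b ax1 0 - a ax1 0 * b ax3 0;
                   a ax1 0 * b ax2 0 - a ax2 0 * b ax1 0]`_i.

(* U = (p, u, H, S); real entries for the background state, complex ones for
   perturbations. *)
Definition plasma (T : Type) : Type := 'cV[T]_(1 + (3 + (3 + 1))).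
Definition p_of (T : Type) (U : plasma T) : T := usubmx U 0 0.
Definition u_of (T : Type) (U : plasma T) : 'cV[T]_3 := usubmx (dsubmx U).
Definition H_of (T : Type) (U : plasma T) : 'cV[T]_3 :=
  usubmx (dsubmx (dsubmx U)).
Definition S_of (T : Type) (U : plasma T) : T :=
  dsubmx (dsubmx (dsubmx U)) 0 0.

(* V = (calH, E) *)
Definition vacuum (T : Type) : Type := 'cV[T]_(3 + 3).
Definition cH_of (T : Type) (V : vacuum T) : 'cV[T]_3 := usubmx V.
Definition E_of (T : Type) (V : vacuum T) : 'cV[T]_3 := dsubmx V.

Definition cmx (R : realType) (m n : nat) (A : 'M[R]_(m, n)) : 'M[R[i]]_(m, n) :=
  map_mx (fun a : R => a%:C) A.

(** * Equation of state *)

Fixpoint Ck_on (R : realType) (V : normedModType R) (D : set V) (k : nat)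
    (f : V -> R) : Prop :=
  match k with
  | 0%N => forall z, D z -> {for z, continuous f}
  | k'.+1 => (forall z, D z -> differentiable f z) /\
             (forall v, Ck_on D k' (fun z => 'D_v f z))
  end.

Definition smooth_on (R : realType) (V : normedModType R) (D : set V)
    (f : V -> R) : Prop := forall k, Ck_on D k f.

(* Density and internal energy as functions of (p, S), smooth on the open set
   of admissible thermodynamic states. *)
Record eos (R : realType) := Eos {
  eos_dom : set (R * R);
  rho_of : R * R -> R;
  energy_of : R * R -> R;
  eos_dom_open : open eos_dom;
  rho_smooth : smooth_on eos_dom rho_of;
  energy_smooth : smooth_on eos_dom energy_of
}.

(** * Plasma matrices *)

Definition rho (R : realType) (e : eos R) (U : plasma R) : R :=
  rho_of e (p_of U, S_of U).

Definition rho_p (R : realType) (e : eos R) (U : plasma R) : R :=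
  'D_((1, 0) : R * R) (rho_of e) (p_of U, S_of U).

Definition enthalpy (R : realType) (e : eos R) (U : plasma R) : R :=
  1 + energy_of e (p_of U, S_of U) + p_of U / rho e U.

Definition a2 (R : realType) (e : eos R) (U : plasma R) : R := 1 / rho_p e U.

Definition cs2 (R : realType) (e : eos R) (U : plasma R) : R :=
  a2 e U / enthalpy e U.

Definition Gam (R : realType) (U : plasma R) : R :=
  Num.sqrt (1 + dot3 (u_of U) (u_of U)).

Definition vel (R : realType) (U : plasma R) : 'cV[R]_3 :=
  (Gam U)^-1 *: u_of U.

Definition bvec (R : realType) (U : plasma R) : 'cV[R]_3 :=
  (Gam U)^-1 *: H_of U + dot3 (u_of U) (H_of U) *: vel U.

Definition Bsq (R : realType) (U : plasma R) : R :=
  dot3 (H_of U) (H_of U) / Gam U ^+ 2 + dot3 (vel U) (H_of U) ^+ 2.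

Definition calA (R : realType) (e : eos R) (U : plasma R) : 'M[R]_3 :=
  let G := Gam U in let v := vel U in let H := H_of U in
  let w := rho e U * enthalpy e U * G in
  let H2 := dot3 H H in
  (w + H2 / G)%:M - (w + (H2 + Bsq U) / G) *: tens3 v v
  - G^-1 *: tens3 H H + (dot3 v H / G) *: (tens3 v H + tens3 H v).

Definition calM (R : realType) (U : plasma R) : 'M[R]_3 :=
  (Gam U)^-1 *: (1%:M + tens3 (u_of U) (u_of U)).

Definition calN (R : realType) (U : plasma R) (j : 'I_3) : 'M[R]_3 :=
  let G := Gam U in let v := vel U in let H := H_of U in let b := bvec U in
  G^-1 *: tens3 b (basis3 R j) - (v j 0 / G) *: tens3 b v
  - (H j 0 / G ^+ 2)%:M.

Definition calAj (R : realType) (e : eos R) (U : plasma R) (j : 'I_3) :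
    'M[R]_3 :=
  let G := Gam U in let v := vel U in let H := H_of U in
  let ej := basis3 R j in
  let w := rho e U * enthalpy e U * G in
  let H2 := dot3 H H in
  v j 0 *: ((w + H2 / G)%:M - (w + (H2 - Bsq U) / G) *: tens3 v v
            - G^-1 *: tens3 H H)
  + (H j 0 / G) *: ((G ^+ 2)^-1 *: (tens3 v H + tens3 H v)
                    - (2 * dot3 v H) *: (1%:M - tens3 v v))
  + (dot3 v H / G) *: (tens3 H ej + tens3 ej H)
  - (Bsq U / G) *: (tens3 v ej + tens3 ej v).

Definition A0 (R : realType) (e : eos R) (U : plasma R) :
    'M[R]_(1 + (3 + (3 + 1))) :=
  let v := vel U in
  col_mx (row_mx (Gam U / (rho e U * a2 e U))%:M
                            (row_mx v^T          (row_mx 0        0)))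
 (col_mx (row_mx v          (row_mx (calA e U)   (row_mx 0        0)))
 (col_mx (row_mx 0          (row_mx 0            (row_mx (calM U) 0)))
         (row_mx 0          (row_mx 0            (row_mx 0        1%:M))))).

Definition Aj (R : realType) (e : eos R) (U : plasma R) (j : 'I_3) :
    'M[R]_(1 + (3 + (3 + 1))) :=
  let v := vel U in let ej := basis3 R j in
  col_mx (row_mx (u_of U j 0 / (rho e U * a2 e U))%:M
                     (row_mx ej^T          (row_mx 0                   0)))
 (col_mx (row_mx ej  (row_mx (calAj e U j) (row_mx (calN U j)^T        0)))
 (col_mx (row_mx 0   (row_mx (calN U j)    (row_mx (v j 0 *: calM U)   0)))
         (row_mx 0   (row_mx 0             (row_mx 0       (v j 0)%:M))))).

(** * Vacuum matrices *)

Definition Bj (T : pzRingType) (j : 'I_3) : 'M[T]_(3 + 3) :=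
  let K := \matrix_(i, k) cross3 (basis3 T j) (basis3 T k) i 0 : 'M[T]_3 in
  block_mx 0 K (- K) 0.

(* [D j] stands for the j-th partial derivative of a vector field. *)
Definition curl3 (T : pzRingType) (D : 'I_3 -> 'cV[T]_3) : 'cV[T]_3 :=
  \col_(i < 3) [:: D ax2 ax3 0 - D ax3 ax2 0;
                   D ax3 ax1 0 - D ax1 ax3 0;
                   D ax1 ax2 0 - D ax2 ax1 0]`_i.

Lemma Bj_sym (T : pzRingType) (j : 'I_3) : (Bj T j)^T = Bj T j.
Proof.
rewrite /Bj tr_block_mx !trmx0; congr block_mx; apply/matrixP => i k;
  case: i => [[|[|[|i]]] hi] //; case: k => [[|[|[|k]]] hk] //;
  case: j => [[|[|[|j]]] hj] //; rewrite /cross3 /basis3 !mxE /= ?mxE /=;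
  by rewrite ?(mulr0, mul0r, mulr1, subr0, sub0r, opprK, oppr0, addr0).
Qed.

Lemma Bj_curl (T : pzRingType) (D : 'I_3 -> vacuum T) :
  \sum_(j < 3) Bj T j *m D j =
  col_mx (curl3 (fun j => E_of (D j))) (- curl3 (fun j => cH_of (D j))).
Proof.
transitivity (\sum_(j < 3)
    col_mx (cross3 (basis3 T j) (E_of (D j)))
           (- cross3 (basis3 T j) (cH_of (D j)))).
  apply: eq_bigr => j _; rewrite -{1}[D j]vsubmxK mul_block_col !mul0mx add0r.
  rewrite addr0 mulNmx -/(E_of _) -/(cH_of _).
  by congr col_mx; [|congr (- _)]; apply/matrixP => i k; rewrite [k]ord1;
    case: i => [[|[|[|i]]] hi] //; case: j => [[|[|[|j]]] hj] //;
    rewrite /cross3 /basis3 !mxE !big_ord_recl big_ord0 !mxE /= ?mxE /=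
      ?(mulr0, mul0r, mulr1, mul1r, subr0, sub0r, addr0, add0r, oppr0, mulN1r) //;
    congr (- D _ _ _) || congr (D _ _ _); apply/val_inj.
rewrite !big_ord_recl big_ord0 addr0 !add_col_mx.
have -> : ord0 = ax1 :> 'I_3 by apply/val_inj.
have -> : lift ax1 ord0 = ax2 by apply/val_inj.
have -> : lift ax1 (lift ord0 ord0) = ax3 by apply/val_inj.
rewrite -!opprD; congr col_mx; [|congr (- _)]; apply/matrixP => i k;
  rewrite [k]ord1; case: i => [[|[|[|i]]] hi] //;
  rewrite !mxE /= ?mxE /= ?(mul0r, mul1r, subr0, sub0r, oppr0, add0r, addr0) //.
all: by rewrite addrC ?(oppr0, addr0, add0r).
Qed.

(** * The linearization point *)

Definition hyperbolic (R : realType) (e : eos R) (Uh : plasma R) : Prop :=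
  [/\ eos_dom e (p_of Uh, S_of Uh), 0 < rho e Uh, 0 < rho_p e Uh
    & 0 < cs2 e Uh < 1].

Definition planar_state (R : realType) (kappa : R) (Uh : plasma R)
    (Vh : vacuum R) : Prop :=
  [/\ vel Uh ax1 0 = kappa, H_of Uh ax1 0 = 0, cH_of Vh ax1 0 = 0,
      E_of Vh ax2 0 = kappa * cH_of Vh ax3 0
    & E_of Vh ax3 0 = - (kappa * cH_of Vh ax2 0)].

(* Perturbations of the velocity and of the total pressure. *)
Definition dvel (R : realType) (Uh : plasma R) (U : plasma R[i]) : 'cV[R[i]]_3 :=
  ((Gam Uh)^-1)%:C *: (u_of U - dot3 (cmx (vel Uh)) (u_of U) *: cmx (vel Uh)).

Definition dq (R : realType) (Uh : plasma R) (U : plasma R[i]) : R[i] :=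
  p_of U + ((Gam Uh)^-1)%:C *
    (dot3 (cmx (bvec Uh)) (H_of U)
     + (dot3 (vel Uh) (H_of Uh))%:C * dot3 (cmx (H_of Uh)) (u_of U)
     - (Bsq Uh)%:C * dot3 (cmx (vel Uh)) (u_of U)).

(** * Fields and their derivatives *)

(* Points (t, x) and, for functions on the interface, (t, x'). *)
Definition spacetime (R : realType) : normedModType R := (R * 'rV[R]_3)%type.
Definition bdry (R : realType) : normedModType R := (R * 'rV[R]_2)%type.

Definition x1_of (R : realType) (z : spacetime R) : R := z.2 0 ax1.
Definition xp_of (R : realType) (z : spacetime R) : 'rV[R]_2 :=
  rsubmx (z.2 : 'rV[R]_(1 + 2)).

(* (t, x') |-> (t, 0, x') *)
Definition bpoint (R : realType) (y : bdry R) : spacetime R :=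
  (y.1, row_mx (0 : 'rV[R]_1) y.2).

Definition dir_t (R : realType) (n : nat) : (R * 'rV[R]_n)%type := (1, 0).
Definition dir_x (R : realType) (n : nat) (j : 'I_n) : (R * 'rV[R]_n)%type :=
  (0, delta_mx 0 j).

(* Derivatives of complex-valued functions of real variables are taken on the
   real and imaginary parts. *)
Definition cderive (R : realType) (V : normedModType R) (f : V -> R[i])
    (v z : V) : R[i] :=
  Complex ('D_v (fun y => complex.Re (f y)) z)
          ('D_v (fun y => complex.Im (f y)) z).

Definition cdifferentiable (R : realType) (V : normedModType R) (f : V -> R[i])
    (z : V) : Prop :=
  differentiable (fun y => complex.Re (f y)) z /\
  differentiable (fun y => complex.Im (f y)) z.

Definition ccontinuous_on (R : realType) (V : normedModType R) (D : set V)
    (f : V -> R[i]) : Prop :=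
  {within D, continuous (fun y => complex.Re (f y))} /\
  {within D, continuous (fun y => complex.Im (f y))}.

Definition vderive (R : realType) (V : normedModType R) (n : nat)
    (W : V -> 'cV[R[i]]_n) (v z : V) : 'cV[R[i]]_n :=
  \col_(i < n) cderive (fun y => W y i 0) v z.

(** * Problem (P) *)

Definition regular_field (R : realType) (n : nat)
    (W : spacetime R -> 'cV[R[i]]_n) : Prop :=
  forall i : 'I_n,
    ccontinuous_on [set z : spacetime R | 0 <= x1_of z] (fun z => W z i 0) /\
    (forall z, 0 < x1_of z -> cdifferentiable (fun y => W y i 0) z).

Definition plasma_eqs (R : realType) (e : eos R) (kappa : R) (Uh : plasma R)
    (F U : spacetime R -> plasma R[i]) : Prop :=
  forall z : spacetime R, 0 < x1_of z ->
    cmx (A0 e Uh) *m vderive U (@dir_t R 3) z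
    + cmx (Aj e Uh ax1 - kappa *: A0 e Uh) *m vderive U (@dir_x R 3 ax1) z
    + cmx (Aj e Uh ax2) *m vderive U (@dir_x R 3 ax2) z
    + cmx (Aj e Uh ax3) *m vderive U (@dir_x R 3 ax3) z = F z.

Definition vacuum_eqs (R : realType) (kappa : R)
    (V : spacetime R -> vacuum R[i]) : Prop :=
  forall z : spacetime R, 0 < x1_of z ->
    vderive V (@dir_t R 3) z
    - cmx (Bj R ax1 - kappa%:M) *m vderive V (@dir_x R 3 ax1) z
    + cmx (Bj R ax2) *m vderive V (@dir_x R 3 ax2) z
    + cmx (Bj R ax3) *m vderive V (@dir_x R 3 ax3) z = 0.

Definition boundary_eqs (R : realType) (kappa : R) (Uh : plasma R)
    (Vh : vacuum R) (U : spacetime R -> plasma R[i])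
    (V : spacetime R -> vacuum R[i]) (phi : bdry R -> R[i]) : Prop :=
  forall y : bdry R,
    let vh j := ((vel Uh j 0)%:C : R[i]) in
    let cHh j := ((cH_of Vh j 0)%:C : R[i]) in
    let Eh j := ((E_of Vh j 0)%:C : R[i]) in
    let cH j := cH_of (V (bpoint y)) j 0 in
    let E j := E_of (V (bpoint y)) j 0 in
    let k := (kappa%:C : R[i]) in
    let phi_t := cderive phi (@dir_t R 2) y in
    let phi_2 := cderive phi (@dir_x R 2 0) y in
    let phi_3 := cderive phi (@dir_x R 2 1) y in
    [/\ phi_t = dvel Uh (U (bpoint y)) ax1 0 - vh ax2 * phi_2 - vh ax3 * phi_3,
        dq Uh (U (bpoint y)) =
          cHh ax2 * (cH ax2 + k * E ax3) + cHh ax3 * (cH ax3 - k * E ax2)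
          - Eh ax1 * E ax1,
        E ax2 = cHh ax3 * phi_t - Eh ax1 * phi_2 + k * cH ax3
      & E ax3 = - (cHh ax2 * phi_t) - Eh ax1 * phi_3 - k * cH ax2].

Definition solves_P (R : realType) (e : eos R) (kappa : R) (Uh : plasma R)
    (Vh : vacuum R) (F U : spacetime R -> plasma R[i])
    (V : spacetime R -> vacuum R[i]) (phi : bdry R -> R[i]) : Prop :=
  [/\ [/\ regular_field U, regular_field V
        & forall y, cdifferentiable phi y],
      plasma_eqs e kappa Uh F U,
      vacuum_eqs kappa V
    & boundary_eqs kappa Uh Vh U V phi].

(** * Exponential solutions *)

Definition cexp (R : realType) (w : R[i]) : R[i] :=
  Complex (expR (complex.Re w) * cos (complex.Im w))
          (expR (complex.Re w) * sin (complex.Im w)).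

Definition front_phase (R : realType) (tau : R) (gamma : 'rV[R]_2)
    (t : R) (x' : 'rV[R]_2) : R[i] :=
  (tau * t)%:C + Complex 0 1 * (\sum_(j < 2) gamma 0 j * x' 0 j)%:C.

Definition field_mode (R : realType) (n : nat) (tau : R) (xi : R[i])
    (gamma : 'rV[R]_2) (W : 'cV[R[i]]_n) (z : spacetime R) : 'cV[R[i]]_n :=
  cexp (front_phase tau gamma z.1 (xp_of z) + xi * (x1_of z)%:C) *: W.

Definition front_mode (R : realType) (tau : R) (gamma : 'rV[R]_2) (phib : R[i])
    (y : bdry R) : R[i] :=
  cexp (front_phase tau gamma y.1 y.2) * phib.

(** * Hadamard-type ill-posedness *)

Definition cabs (R : realType) (w : R[i]) : R :=
  Num.sqrt (complex.Re w ^+ 2 + complex.Im w ^+ 2).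

(* Iterated spatial partial derivative along the list of directions s. *)
Definition cderive_x (R : realType) (n : nat) (s : seq 'I_n)
    (f : (R * 'rV[R]_n)%type -> R[i]) : (R * 'rV[R]_n)%type -> R[i] :=
  foldr (fun j g => cderive g (@dir_x R n j)) f s.

(* On the set D of space points, the initial data of the sequence f tend to 0
   uniformly with all their derivatives. *)
Definition data_vanish (R : realType) (n : nat) (D : set 'rV[R]_n)
    (f : nat -> (R * 'rV[R]_n)%type -> R[i]) : Prop :=
  forall (s : seq 'I_n) (eps : R), 0 < eps ->
    \forall k \near \oo, forall x, D x -> cabs (cderive_x s (f k) (0, x)) < eps.

(* A sequence (k = 1, 2, ...) of solutions of the homogeneous problem whose
   initial data tend to 0 in every C^m, while at each t > 0 the sup norm of
   (U, V) over the half-space tends to infinity. *)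
Definition hadamard_sequence (R : realType) (e : eos R) (kappa : R)
    (Uh : plasma R) (Vh : vacuum R)
    (U : nat -> spacetime R -> plasma R[i])
    (V : nat -> spacetime R -> vacuum R[i])
    (phi : nat -> bdry R -> R[i]) : Prop :=
  [/\ forall k, (0 < k)%N ->
        solves_P e kappa Uh Vh (fun=> 0) (U k) (V k) (phi k),
      [/\ forall i, data_vanish [set x | 0 < x 0 ax1] (fun k z => U k z i 0),
          forall i, data_vanish [set x | 0 < x 0 ax1] (fun k z => V k z i 0)
        & data_vanish setT phi]
    & forall t M : R, 0 < t ->
        \forall k \near \oo, exists2 x : 'rV[R]_3, 0 < x 0 ax1 &
          (exists i, M < cabs (U k (t, x) i 0)) \/
          (exists i, M < cabs (V k (t, x) i 0))].

Definition rescale_field (R : realType) (n : nat)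
    (W : spacetime R -> 'cV[R[i]]_n) (k : nat) (z : spacetime R) : 'cV[R[i]]_n :=
  (expR (- Num.sqrt k%:R))%:C *: W (k%:R * z.1, k%:R *: z.2).

(* The boundary conditions are of order 0 in (U, V) and of order 1 in phi, so
   that (t, x) |-> (kt, kx) maps solutions to solutions only together with the
   factor 1/k on phi. *)
Definition rescale_front (R : realType) (phi : bdry R -> R[i]) (k : nat)
    (y : bdry R) : R[i] :=
  (expR (- Num.sqrt k%:R) / k%:R)%:C * phi (k%:R * y.1, k%:R *: y.2).

(* Main.v *)
From HB Require Import structures.
Require Import Defs.
From mathcomp Require Import all_boot all_order all_algebra.
From mathcomp Require Import complex.
From mathcomp Require Import all_classical all_reals all_analysis.
From mathcomp Require Import ring lra.

Set Implicit Arguments.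
Unset Strict Implicit.
Unset Printing Implicit Defensive.

Import Order.TTheory GRing.Theory Num.Theory.
Import numFieldNormedType.Exports.
Local Open Scope ring_scope.

(** For exponentials with tangential frequency (1, 0) the amplitudes of both
    fields can be computed from that of the front.  Put [s = sqrt (1 + tau^2)].
    In the vacuum [xi_v = - s] is the decaying exponent, and the boundary
    conditions on [E_2] and [E_3] determine [V].  In the plasma the background
    velocity and magnetic field point along the third axis, so that the blocks
    of the symbol acting on these modes are combinations of the identity and of
    matrix units; eliminating the unknowns leaves
    [xi_p^2 = 1 + K tau^2] with [K > 0], the positivity being a consequence of
    [c_s^2 < 1] and [|v| < 1].  With [r = - xi_p], the balance of total
    pressure at the interface is then, with [E_1] and [cH_2] components of the
    constant vacuum state, the dispersion relation
<<
      tau^2 a / r = E_1^2 / s - cH_2^2 s,       a > 0.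
>>
    At [tau = 0] the right-hand side equals [E_1^2 - cH_2^2 > 0] while the left
    one vanishes; the right-hand side vanishes at
    [tau^2 = (E_1^2 - cH_2^2) / cH_2^2] while the left one is positive.  A
    positive root exists by the intermediate value theorem
    ([dispersion_root]), and [aligned_symbol_solution] writes the
    corresponding amplitudes explicitly.

    Differentiating an exponential multiplies it by a constant, so problem (P)
    for exponentials is the linear algebraic system [symbol_solution]
    ([symbol_solution_solves_P]).  That system is invariant under dilation of
    the frequencies ([symbol_solution_scale]), hence the rescaled fields solve
    (P) too.  Their data and all derivatives of these are bounded by
    [C k^m exp (- sqrt k)], whereas at a time [t > 0] the factor
    [exp (k tau t - sqrt k)] prevails ([symbol_solution_hadamard]). *)

(** * Linear forms and exponential waves *)

(** The pairing of a covector [P] with a point [z]; both are pairs (time, space). *)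
Definition form (R : realType) (n : nat) (P z : (R * 'rV[R]_n)%type) : R :=
  P.1 * z.1 + \sum_(j < n) P.2 0 j * z.2 0 j.

Lemma form_linear (R : realType) (n : nat) (P : (R * 'rV[R]_n)%type) :
  linear (form P : (R * 'rV[R]_n)%type -> R).
Proof.
move=> a y z; rewrite /form /= mulrDr scalerDr addrACA; congr (_ + _).
  by rewrite /GRing.scale /=; ring.
rewrite scaler_sumr -big_split; apply: eq_bigr => j _ /=.
by rewrite !mxE /GRing.scale /=; ring.
Qed.

HB.instance Definition _ (R : realType) (n : nat) (P : (R * 'rV[R]_n)%type) :=
  GRing.isLinear.Build R (R * 'rV[R]_n)%type R _ (form P) (form_linear P).

Lemma continuous_form (R : realType) (n : nat) (P : (R * 'rV[R]_n)%type) :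
  continuous (form P).
Proof.
move=> z; apply: cvgD; first by apply: cvgMr; exact: cvg_fst.
apply: cvg_big => [|j _]; [exact: add_continuous|apply: cvgMr].
apply: (@cvg_comp _ _ _ snd (fun M : 'rV[R]_n => M 0 j)); first exact: cvg_snd.
exact: coord_continuous.
Qed.

Lemma is_diff_form (R : realType) (n : nat) (P z : (R * 'rV[R]_n)%type) :
  is_diff z (form P) (form P).
Proof.
split; first exact: linear_differentiable (@continuous_form _ _ P).
exact: diff_lin (@continuous_form _ _ P).
Qed.

Lemma form_dir_t (R : realType) (n : nat) (P : (R * 'rV[R]_n)%type) :
  form P (dir_t R n) = P.1.
Proof. by rewrite /form /= mulr1 big1 ?addr0 // => j _; rewrite mxE mulr0. Qed.

Lemma form_dir_x (R : realType) (n : nat) (P : (R * 'rV[R]_n)%type) (j : 'I_n) :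
  form P (dir_x R j) = P.2 0 j.
Proof.
rewrite /form /= mulr0 add0r (bigD1 j) //= big1 ?addr0 => [|i /negbTE ij].
  by rewrite mxE !eqxx mulr1.
by rewrite mxE eqxx ij mulr0.
Qed.

(** The exponential of [P . z + i Q . z]. *)
Definition wave (R : realType) (n : nat) (P Q z : (R * 'rV[R]_n)%type) : R[i] :=
  cexp (Complex (form P z) (form Q z)).

(** The factor by which differentiation along [v] acts on [wave P Q]. *)
Definition wave_rate (R : realType) (n : nat) (P Q v : (R * 'rV[R]_n)%type) :
  R[i] := Complex (form P v) (form Q v).

(** Both the real and the imaginary part of [wave P Q z * w] have this form, with
    suitable [c] and [s]. *)
Lemma is_diff_wave (R : realType) (n : nat) (P Q z : (R * 'rV[R]_n)%type)
    (c s : R) :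
  is_diff z (fun y => expR (form P y) * (c * cos (form Q y) + s * sin (form Q y)))
   (fun v => expR (form P z) *
      (form P v * (c * cos (form Q z) + s * sin (form Q z))
       + form Q v * (s * cos (form Q z) - c * sin (form Q z)))).
Proof.
have dP := is_diff_form P z; have dQ := is_diff_form Q z.
have dc (f : R -> R) (df : R) (N : (R * 'rV[R]_n)%type) :
    is_derive (form N z) 1 f df -> is_diff z (f \o form N) (fun v => df * form N v).
  move=> df1; have dN := is_diff_form N z.
  have df2 : is_diff (form N z) f (fun t => df * t).
    have fd : differentiable f (form N z) by apply/derivable1_diffP.
    split=> //; rewrite diff1E // derive1E derive_val.
    by apply/funext => t /=; rewrite mulrC.
  by apply: is_diff_eq.
have dE := dc _ _ P (is_derive_expR _).
have dC := dc _ _ Q (is_derive_cos _).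
have dS := dc _ _ Q (is_derive_sin _).
pose E := expR \o form P; pose C := cos \o form Q; pose S := sin \o form Q.
have -> : (fun y => expR (form P y) * (c * cos (form Q y) + s * sin (form Q y)))
  = E * (c *: C + s *: S) by [].
have dsum := is_diffD (is_diffZ c dC) (is_diffZ s dS).
apply: (@is_diff_eq _ _ _ _ _ _ _ (is_diffM dE dsum)).
apply/funext => v; rewrite /E /C /S /= !fctE /=.
rewrite /GRing.scale /=; ring.
Qed.

Lemma cdifferentiable_wave (R : realType) (n : nat) (P Q z : (R * 'rV[R]_n)%type)
  (w : R[i]) : cdifferentiable (fun y => wave P Q y * w) z.
Proof.
case: w => a b; split.
  have -> : (fun y => complex.Re (wave P Q y * Complex a b)) =
      (fun y => expR (form P y) * (a * cos (form Q y) + (- b) * sin (form Q y))).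
    by apply/funext => y /=; ring.
  by case: (is_diff_wave P Q z a (- b)).
have -> : (fun y => complex.Im (wave P Q y * Complex a b)) =
    (fun y => expR (form P y) * (b * cos (form Q y) + a * sin (form Q y))).
  by apply/funext => y /=; ring.
by case: (is_diff_wave P Q z b a).
Qed.

Lemma cderive_wave (R : realType) (n : nat) (P Q z v : (R * 'rV[R]_n)%type)
  (w : R[i]) :
  cderive (fun y => wave P Q y * w) v z
  = wave P Q z * (wave_rate P Q v * w).
Proof.
case: w => a b; rewrite /cderive.
have -> : (fun y => complex.Re (wave P Q y * Complex a b)) =
    (fun y => expR (form P y) * (a * cos (form Q y) + (- b) * sin (form Q y))).
  by apply/funext => y /=; ring.
have -> : (fun y => complex.Im (wave P Q y * Complex a b)) =
    (fun y => expR (form P y) * (b * cos (form Q y) + a * sin (form Q y))).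
  by apply/funext => y /=; ring.
have [dr drE] := is_diff_wave P Q z a (- b).
have [di diE] := is_diff_wave P Q z b a.
rewrite (deriveE _ dr) (deriveE _ di) drE diE.
apply/eqP; rewrite eq_complex /=.
by apply/andP; split; apply/eqP; ring.
Qed.

(** Covectors of the real and of the imaginary part of the exponent
    [tau t + xi x^1 + i (gamma, x')]. *)
Definition growth_covector (R : realType) (tau : R) (xi : R[i]) :
    (R * 'rV[R]_3)%type :=
  (tau, row_mx (complex.Re xi)%:M (0 : 'rV[R]_2)).

Definition wave_covector (R : realType) (xi : R[i]) (gamma : 'rV[R]_2) :
    (R * 'rV[R]_3)%type :=
  (0, row_mx (complex.Im xi)%:M gamma).

Lemma form_row_mx (R : realType) (c d : R) (g : 'rV[R]_2) (z : spacetime R) :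
  form (c, row_mx d%:M g) z
  = c * z.1 + d * x1_of z + \sum_(j < 2) g 0 j * xp_of z 0 j.
Proof.
rewrite /form -addrA; congr (_ + _) => /=.
rewrite (@big_split_ord _ _ _ 1 2) /= big_ord1; congr (_ + _).
  rewrite row_mxEl mxE eqxx mulr1n /x1_of; congr (_ * z.2 _ _).
  exact: val_inj.
by apply: eq_bigr => j _; rewrite row_mxEr /xp_of mxE.
Qed.

Lemma form_growth (R : realType) (tau : R) (xi : R[i]) (z : spacetime R) :
  form (growth_covector tau xi) z = tau * z.1 + complex.Re xi * x1_of z.
Proof.
by rewrite form_row_mx [X in _ + X]big1 ?addr0 // => j _; rewrite mxE mul0r.
Qed.

Lemma field_modeE (R : realType) (n : nat) (tau : R) (xi : R[i])
    (gamma : 'rV[R]_2) (W : 'cV[R[i]]_n) (z : spacetime R) :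
  field_mode tau xi gamma W z
  = wave (growth_covector tau xi) (wave_covector xi gamma) z *: W.
Proof.
congr (cexp _ *: _); case: xi => a b.
rewrite /growth_covector /wave_covector !form_row_mx /front_phase.
rewrite [\sum_(j < 2) (0 : 'rV__) _ _ * _]big1 => [|j _]; last by rewrite mxE mul0r.
by apply/eqP; rewrite eq_complex /=; apply/andP; split; apply/eqP; ring.
Qed.

Lemma front_modeE (R : realType) (tau : R) (gamma : 'rV[R]_2) (phib : R[i])
    (y : bdry R) :
  front_mode tau gamma phib y = wave (tau, 0) (0, gamma) y * phib.
Proof.
congr (cexp _ * _); rewrite /front_phase /form /=.
rewrite [X in Complex (_ + X)]big1 => [|j _]; last by rewrite mxE mul0r.
by apply/eqP; rewrite eq_complex /=; apply/andP; split; apply/eqP; ring.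
Qed.

Local Open Scope complex_scope.

(** * Modes and the symbol of problem (P) *)

Section ModeRate.
Variables (R : realType) (tau : R) (xi : R[i]) (gamma : 'rV[R]_2).

(** The factor by which differentiation along [v] acts on a mode. *)
Definition mode_rate (v : spacetime R) : R[i] :=
  wave_rate (growth_covector tau xi) (wave_covector xi gamma) v.

Lemma mode_rate_t : mode_rate (dir_t R 3) = tau%:C.
Proof. by rewrite /mode_rate /wave_rate !form_dir_t. Qed.

Lemma mode_rate_x1 : mode_rate (dir_x R ax1) = xi.
Proof.
rewrite /mode_rate /wave_rate !form_dir_x /=.
rewrite (_ : ax1 = lshift 2 (0 : 'I_1)); last exact: val_inj.
by rewrite !(@row_mxEl _ 1 1 2) !mxE eqxx !mulr1n; case: xi.
Qed.

Lemma mode_rate_xp (j : 'I_2) :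
  mode_rate (dir_x R (rshift 1 j)) = Complex 0 (gamma 0 j).
Proof.
by rewrite /mode_rate /wave_rate !form_dir_x /= !(@row_mxEr _ 1 1 2) !mxE.
Qed.

Lemma mode_rate_x2 : mode_rate (dir_x R ax2) = Complex 0 (gamma 0 0).
Proof. by rewrite -mode_rate_xp; congr (mode_rate (dir_x _ _)); exact: val_inj. Qed.

Lemma mode_rate_x3 : mode_rate (dir_x R ax3) = Complex 0 (gamma 0 1).
Proof. by rewrite -mode_rate_xp; congr (mode_rate (dir_x _ _)); exact: val_inj. Qed.
End ModeRate.

Lemma vderive_field_mode (R : realType) (n : nat) (tau : R) (xi : R[i])
    (gamma : 'rV[R]_2) (W : 'cV[R[i]]_n) (v z : spacetime R) :
  vderive (field_mode tau xi gamma W) v z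
  = wave (growth_covector tau xi) (wave_covector xi gamma) z *:
      (mode_rate tau xi gamma v *: W).
Proof.
apply/colP => i; rewrite 3!mxE.
have -> : (fun y => field_mode tau xi gamma W y i 0) = (fun y =>
    wave (growth_covector tau xi) (wave_covector xi gamma) y * W i 0).
  by apply/funext => y; rewrite field_modeE mxE.
exact: cderive_wave.
Qed.

(** The four terms of an interior equation evaluated on a mode, with the common
    exponential factor [w] taken out. *)
Lemma mulmx_symbol4 (T : comPzRingType) (n : nat) (A B C D : 'M[T]_n)
    (W : 'cV[T]_n) (w a b c d : T) :
  A *m (w *: (a *: W)) + B *m (w *: (b *: W)) + C *m (w *: (c *: W))
    + D *m (w *: (d *: W))
  = w *: ((a *: A + b *: B + c *: C + d *: D) *m W).
Proof.
by rewrite !mulmxDl -!scalemxAl -!scalemxAr -!scalerDr.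
Qed.

(** The matrix [tau A_0 + xi A_1 + i gamma_1 A_2 + i gamma_2 A_3] of the interior
    equations of the plasma on modes, and its analogue for the vacuum. *)
Definition plasma_symbol (R : realType) (e : eos R) (kappa : R) (Uh : plasma R)
    (tau : R) (xi : R[i]) (gamma : 'rV[R]_2) : 'M[R[i]]_(1 + (3 + (3 + 1))) :=
  tau%:C *: cmx (A0 e Uh) + xi *: cmx (Aj e Uh ax1 - kappa *: A0 e Uh)
  + Complex 0 (gamma 0 0) *: cmx (Aj e Uh ax2)
  + Complex 0 (gamma 0 1) *: cmx (Aj e Uh ax3).

Definition vacuum_symbol (R : realType) (kappa tau : R) (xi : R[i])
    (gamma : 'rV[R]_2) : 'M[R[i]]_(3 + 3) :=
  tau%:C *: 1%:M - xi *: cmx (Bj R ax1 - kappa%:M)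
  + Complex 0 (gamma 0 0) *: cmx (Bj R ax2)
  + Complex 0 (gamma 0 1) *: cmx (Bj R ax3).

(** The boundary conditions for amplitudes, with the derivatives of the front
    replaced by [tau phi] and [i gamma_j phi]. *)
Definition boundary_symbol (R : realType) (kappa : R) (Uh : plasma R)
    (Vh : vacuum R) (tau : R) (gamma : 'rV[R]_2)
    (U : plasma R[i]) (V : vacuum R[i]) (phi : R[i]) : Prop :=
  let vh j := ((vel Uh j 0)%:C : R[i]) in
  let cHh j := ((cH_of Vh j 0)%:C : R[i]) in
  let Eh j := ((E_of Vh j 0)%:C : R[i]) in
  let k := (kappa%:C : R[i]) in
  let phi_t := tau%:C * phi in
  let phi_2 := Complex 0 (gamma 0 0) * phi in
  let phi_3 := Complex 0 (gamma 0 1) * phi in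
  [/\ phi_t = dvel Uh U ax1 0 - vh ax2 * phi_2 - vh ax3 * phi_3,
      dq Uh U =
        cHh ax2 * (cH_of V ax2 0 + k * E_of V ax3 0)
        + cHh ax3 * (cH_of V ax3 0 - k * E_of V ax2 0) - Eh ax1 * E_of V ax1 0,
      E_of V ax2 0 = cHh ax3 * phi_t - Eh ax1 * phi_2 + k * cH_of V ax3 0
    & E_of V ax3 0 = - (cHh ax2 * phi_t) - Eh ax1 * phi_3 - k * cH_of V ax2 0].

(** Amplitudes and frequencies for which the modes solve problem (P) with [F = 0]. *)
Definition symbol_solution (R : realType) (e : eos R) (kappa : R)
    (Uh : plasma R) (Vh : vacuum R) (tau : R) (xip xiv : R[i])
    (gamma : 'rV[R]_2) (U : plasma R[i]) (V : vacuum R[i]) (phi : R[i]) : Prop :=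
  [/\ plasma_symbol e kappa Uh tau xip gamma *m U = 0,
      vacuum_symbol kappa tau xiv gamma *m V = 0
    & boundary_symbol kappa Uh Vh tau gamma U V phi].

Lemma dot3Z (T : comPzRingType) (a : T) (b c : 'cV[T]_3) :
  dot3 b (a *: c) = a * dot3 b c.
Proof. by rewrite /dot3 big_distrr; apply: eq_bigr => i _ /=; rewrite mxE; ring. Qed.

Lemma p_ofZ (T : pzRingType) (a : T) (U : plasma T) : p_of (a *: U) = a * p_of U.
Proof. by rewrite /p_of !mxE. Qed.
Lemma u_ofZ (T : pzRingType) (a : T) (U : plasma T) : u_of (a *: U) = a *: u_of U.
Proof. by apply/matrixP => i j; rewrite !mxE. Qed.
Lemma H_ofZ (T : pzRingType) (a : T) (U : plasma T) : H_of (a *: U) = a *: H_of U.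
Proof. by apply/matrixP => i j; rewrite !mxE. Qed.
Lemma cH_ofZ (T : pzRingType) (a : T) (V : vacuum T) j :
  cH_of (a *: V) j 0 = a * cH_of V j 0.
Proof. by rewrite !mxE. Qed.
Lemma E_ofZ (T : pzRingType) (a : T) (V : vacuum T) j :
  E_of (a *: V) j 0 = a * E_of V j 0.
Proof. by rewrite !mxE. Qed.

Lemma dvelZ (R : realType) (Uh : plasma R) (a : R[i]) (U : plasma R[i]) j :
  dvel Uh (a *: U) j 0 = a * dvel Uh U j 0.
Proof. by rewrite /dvel u_ofZ dot3Z !mxE; ring. Qed.

Lemma dqZ (R : realType) (Uh : plasma R) (a : R[i]) (U : plasma R[i]) :
  dq Uh (a *: U) = a * dq Uh U.
Proof. by rewrite /dq p_ofZ u_ofZ H_ofZ !dot3Z; ring. Qed.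

(** The boundary conditions are of order 1 in the front and of order 0 in the
    fields, whence the factor [c / k] on [phi]. *)
Lemma symbol_solution_scale (R : realType) (e : eos R) (kappa : R)
    (Uh : plasma R) (Vh : vacuum R) (tau : R) (xip xiv : R[i])
    (gamma : 'rV[R]_2) (U : plasma R[i]) (V : vacuum R[i]) (phi : R[i])
    (k : R) (c : R[i]) :
  k != 0 ->
  symbol_solution e kappa Uh Vh tau xip xiv gamma U V phi ->
  symbol_solution e kappa Uh Vh (k * tau) (k%:C * xip) (k%:C * xiv)
    (k *: gamma) (c *: U) (c *: V) (c / k%:C * phi).
Proof.
move=> k0 [hU hV [b1 b2 b3 b4]].
have kC : k%:C != 0 :> R[i] by rewrite fmorph_eq0.
have cst (g : R) : Complex 0 (k * g) = k%:C * Complex 0 g.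
  by apply/eqP; rewrite eq_complex /=; apply/andP; split; apply/eqP; ring.
split.
- rewrite /plasma_symbol ![(k *: gamma) _ _]mxE rmorphM !cst -!scalerA -!scalerDr.
  by rewrite -scalemxAl -scalemxAr hU !scaler0.
- rewrite /vacuum_symbol ![(k *: gamma) _ _]mxE rmorphM !cst.
  rewrite -!scalerA -scalerBr -!scalerDr.
  by rewrite -scalemxAl -scalemxAr hV !scaler0.
- rewrite /boundary_symbol dvelZ dqZ !cH_ofZ !E_ofZ ![(k *: gamma) _ _]mxE.
  rewrite rmorphM !cst.
  split.
  + have -> : k%:C * tau%:C * (c / k%:C * phi) = c * (tau%:C * phi) by field.
    by rewrite b1; field.
  + by rewrite b2; ring.
  + by rewrite b3; field.
  + by rewrite b4; field.
Qed.

Lemma regular_field_mode (R : realType) (n : nat) (tau : R) (xi : R[i])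
    (gamma : 'rV[R]_2) (W : 'cV[R[i]]_n) :
  regular_field (field_mode tau xi gamma W).
Proof.
move=> i.
have -> : (fun z => field_mode tau xi gamma W z i 0) = (fun z =>
    wave (growth_covector tau xi) (wave_covector xi gamma) z * W i 0).
  by apply/funext => z; rewrite field_modeE mxE.
have d z := cdifferentiable_wave (growth_covector tau xi)
  (wave_covector xi gamma) z (W i 0).
split=> [|z _]; last exact: d.
by split; apply: continuous_subspaceT => z; apply: differentiable_continuous;
  case: (d z).
Qed.

Lemma symbol_solution_solves_P (R : realType) (e : eos R) (kappa : R)
    (Uh : plasma R) (Vh : vacuum R) (tau : R) (xip xiv : R[i])
    (gamma : 'rV[R]_2) (U : plasma R[i]) (V : vacuum R[i]) (phi : R[i]) :
  symbol_solution e kappa Uh Vh tau xip xiv gamma U V phi ->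
  solves_P e kappa Uh Vh (fun=> 0) (field_mode tau xip gamma U)
    (field_mode tau xiv gamma V) (front_mode tau gamma phi).
Proof.
move=> [hU hV [b1 b2 b3 b4]].
have frontE : front_mode tau gamma phi = fun y => wave (tau, 0) (0, gamma) y * phi.
  by apply/funext => y; rewrite front_modeE.
split.
- split; [exact: regular_field_mode|exact: regular_field_mode|move=> y].
  by rewrite frontE; exact: cdifferentiable_wave.
- move=> z _; rewrite !vderive_field_mode mode_rate_t mode_rate_x1.
  rewrite mode_rate_x2 mode_rate_x3.
  by rewrite mulmx_symbol4 -/(plasma_symbol _ _ _ _ _ _) hU scaler0.
- move=> z _; rewrite !vderive_field_mode mode_rate_t mode_rate_x1.
  rewrite mode_rate_x2 mode_rate_x3.
  rewrite -[W in W - _]mul1mx -mulNmx mulmx_symbol4 scalerN.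
  by rewrite -/(vacuum_symbol _ _ _ _) hV scaler0.
- move=> y.
  have modeE m (xi : R[i]) (W : 'cV[R[i]]_m) :
      field_mode tau xi gamma W (bpoint y) = wave (tau, 0) (0, gamma) y *: W.
    rewrite /field_mode -[wave _ _ _]mulr1 -front_modeE /front_mode mulr1.
    congr (cexp _ *: _); rewrite /x1_of /xp_of /bpoint /=.
    rewrite row_mxKr (_ : ax1 = lshift 2 (0 : 'I_1)); last exact: val_inj.
    by rewrite (@row_mxEl _ 1 1 2) mxE mulr0 addr0.
  rewrite /= !modeE frontE !cderive_wave /wave_rate !form_dir_t !form_dir_x /=.
  rewrite ![(0 : 'rV__) _ _]mxE -/(tau%:C) dvelZ dqZ !cH_ofZ !E_ofZ.
  split.
  + by rewrite b1; ring.
  + by rewrite b2; ring.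
  + by rewrite b3; ring.
  + by rewrite b4; ring.
Qed.

(** * Hadamard sequences *)

Lemma formZl (R : realType) (n : nat) (k : R) (P z : (R * 'rV[R]_n)%type) :
  form (k *: P) z = k * form P z.
Proof.
rewrite /form /= mulrDr mulr_sumr /GRing.scale /= mulrA; congr (_ + _).
by apply: eq_bigr => j _; rewrite mxE mulrA.
Qed.

Lemma formZr (R : realType) (n : nat) (k : R) (P z : (R * 'rV[R]_n)%type) :
  form P (k *: z) = k * form P z.
Proof. exact: linearZ. Qed.

Lemma growth_covectorZ (R : realType) (k tau : R) (xi : R[i]) :
  growth_covector (k * tau) (k%:C * xi) = k *: growth_covector tau xi.
Proof.
case: xi => a b; congr pair; apply/rowP => j; rewrite !mxE.
by case: (@fintype.split 1 2 j) => i; rewrite !mxE ?mulr0 //= mul0r subr0 mulrnAr.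
Qed.

Lemma wave_covectorZ (R : realType) (k : R) (xi : R[i]) (gamma : 'rV[R]_2) :
  wave_covector (k%:C * xi) (k *: gamma) = k *: wave_covector xi gamma.
Proof.
case: xi => a b; congr pair; first by rewrite /GRing.scale /= mulr0.
apply/rowP => j; rewrite !mxE.
by case: (@fintype.split 1 2 j) => i; rewrite !mxE //= mul0r addr0 mulrnAr.
Qed.

Lemma waveZ (R : realType) (n : nat) (k : R) (P Q z : (R * 'rV[R]_n)%type) :
  wave P Q (k * z.1, k *: z.2) = wave (k *: P) (k *: Q) z.
Proof.
by rewrite /wave !formZl -[(_, _)]/(k *: z) !formZr.
Qed.

Lemma rescale_field_mode (R : realType) (n : nat) (tau : R) (xi : R[i])
    (gamma : 'rV[R]_2) (W : 'cV[R[i]]_n) (k : nat) :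
  rescale_field (field_mode tau xi gamma W) k
  = field_mode (k%:R * tau) ((k%:R : R)%:C * xi) (k%:R *: gamma)
      ((expR (- Num.sqrt k%:R))%:C *: W).
Proof.
apply/funext => z.
rewrite /rescale_field !field_modeE growth_covectorZ wave_covectorZ waveZ.
by rewrite !scalerA mulrC.
Qed.

Lemma front_waveZ (R : realType) (k tau : R) (gamma : 'rV[R]_2) :
  wave (k * tau, 0) (0, k *: gamma)
  = wave (k *: ((tau, 0) : R * 'rV[R]_2)) (k *: ((0, gamma) : R * 'rV[R]_2)).
Proof.
have -> : k *: ((tau, 0) : R * 'rV[R]_2) = (k * tau, 0).
  by congr pair; rewrite /= scaler0.
have -> // : k *: ((0, gamma) : R * 'rV[R]_2) = (0, k *: gamma).
by congr pair; rewrite /= /GRing.scale /= mulr0.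
Qed.

Lemma rescale_front_mode (R : realType) (tau : R) (gamma : 'rV[R]_2)
    (phib : R[i]) (k : nat) :
  rescale_front (front_mode tau gamma phib) k
  = front_mode (k%:R * tau) (k%:R *: gamma)
      ((expR (- Num.sqrt k%:R) / k%:R)%:C * phib).
Proof.
apply/funext => y; rewrite /rescale_front !front_modeE waveZ.
by rewrite front_waveZ mulrCA.
Qed.

Lemma cabs_realM (R : realType) (a : R) (w : R[i]) :
  cabs (a%:C * w) = `|a| * cabs w.
Proof.
case: w => x y; rewrite /cabs /= !mul0r subr0 addr0.
by rewrite -sqrtr_sqr -sqrtrM ?sqr_ge0 //; congr Num.sqrt; ring.
Qed.

Lemma cabs_waveM (R : realType) (n : nat) (P Q z : (R * 'rV[R]_n)%type)
  (w : R[i]) : cabs (wave P Q z * w) = expR (form P z) * cabs w.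
Proof.
case: w => x y; rewrite /cabs /=.
set E := expR _; set c := cos _; set s := sin _.
have E0 : 0 <= E by exact: expR_ge0.
rewrite -[in RHS](ger0_norm E0) -sqrtr_sqr -sqrtrM ?sqr_ge0 //.
congr Num.sqrt.
have cs : c ^+ 2 + s ^+ 2 = 1 by exact: cos2Dsin2.
transitivity (E ^+ 2 * ((c ^+ 2 + s ^+ 2) * (x ^+ 2 + y ^+ 2))); last first.
  by rewrite cs mul1r.
by ring.
Qed.

Lemma cabs_ge0 (R : realType) (w : R[i]) : 0 <= cabs w.
Proof. exact: sqrtr_ge0. Qed.

Lemma cabs_gt0 (R : realType) (w : R[i]) : w != 0 -> 0 < cabs w.
Proof.
case: w => x y; rewrite eq_complex negb_and sqrtr_gt0 /= => /orP[] h.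
  by rewrite ltr_pwDl ?sqr_ge0 // lt_neqAle sqr_ge0 eq_sym sqrf_eq0 h.
by rewrite ltr_wpDl ?sqr_ge0 // lt_neqAle sqr_ge0 eq_sym sqrf_eq0 h.
Qed.

Lemma cderive_x_wave (R : realType) (n : nat) (P Q : (R * 'rV[R]_n)%type)
    (w : R[i]) (s : seq 'I_n) :
  cderive_x s (fun z => wave P Q z * w)
  = fun z => wave P Q z * ((\prod_(j <- s) wave_rate P Q (dir_x R j)) * w).
Proof.
elim: s => [|j s IHs] /=.
  by apply/funext => z; rewrite big_nil mul1r.
apply/funext => z; rewrite /cderive_x /= -/(cderive_x s _) IHs cderive_wave.
by rewrite big_cons !mulrA.
Qed.

Lemma wave_rate_scale_prod (R : realType) (n : nat) (k : R)
    (P Q : (R * 'rV[R]_n)%type) (s : seq 'I_n) :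
  \prod_(j <- s) wave_rate (k *: P) (k *: Q) (dir_x R j)
  = (k ^+ size s)%:C * \prod_(j <- s) wave_rate P Q (dir_x R j).
Proof.
elim: s => [|j s IHs]; first by rewrite !big_nil expr0 mulr1.
rewrite !big_cons IHs /= exprS rmorphM.
have -> : wave_rate (k *: P) (k *: Q) (dir_x R j)
    = k%:C * wave_rate P Q (dir_x R j).
  rewrite /wave_rate !formZl.
  by apply/eqP; rewrite eq_complex /=; apply/andP; split; apply/eqP; ring.
by ring.
Qed.

(** Powers of [k] are negligible against [exp (sqrt k)]: this is the term of
    degree [2 (m + 1)] of the exponential series at [sqrt k]. *)
Lemma natX_expR_sqrt (R : realType) (m k : nat) :
  (k%:R : R) ^+ m.+1 * expR (- Num.sqrt k%:R) <= (m.+1.*2)`!%:R.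
Proof.
have s0 : 0 <= Num.sqrt (k%:R : R) by exact: sqrtr_ge0.
have := expR_ge1Dxn (m.*2.+1) s0.
rewrite -[m.*2.+2]/(m.+1.*2) -[X in _ ^+ X]mul2n exprM sqr_sqrtr ?ler0n //.
move=> h; rewrite expRN ler_pdivrMr ?expR_gt0 //.
have f0 : 0 < (m.+1.*2)`!%:R :> R by rewrite ltr0n fact_gt0.
rewrite mulrC -ler_pdivrMr //; apply: le_trans h.
by rewrite lerDr.
Qed.

(** Differentiation in space brings out powers of [k] only, while [exp (k P . x)]
    is at most 1 on [D]. *)
Lemma data_vanish_wave (R : realType) (n : nat) (P Q : (R * 'rV[R]_n)%type)
    (D : set 'rV[R]_n) (c : nat -> R) (w : R[i])
    (f : nat -> (R * 'rV[R]_n)%type -> R[i]) :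
  (forall x, D x -> form P (0, x) <= 0) ->
  (forall k, `|c k| <= expR (- Num.sqrt k%:R)) ->
  (forall k, f k = fun z => wave (k%:R *: P) (k%:R *: Q) z * ((c k)%:C * w)) ->
  data_vanish D f.
Proof.
move=> hP hc hf s eps eps0.
set A := cabs ((\prod_(j <- s) wave_rate P Q (dir_x R j)) * w).
pose F : R := ((size s).+1.*2)`!%:R.
near=> k => x Dx.
have k0 : 0 < (k%:R : R) by near: k; exact: nbhs_infty_gtr.
rewrite hf cderive_x_wave cabs_waveM wave_rate_scale_prod.
rewrite formZl mulrACA -rmorphM cabs_realM -/A.
apply: (@le_lt_trans _ _ (F * A / k%:R)); last first.
  rewrite ltr_pdivrMr // -ltr_pdivrMl //.
  by near: k; exact: nbhs_infty_gtr.
have e1 : expR (k%:R * form P (0, x)) <= 1.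
  by rewrite expR_le1 pmulr_rle0 // hP.
apply: (@le_trans _ _ (1 * (`|k%:R ^+ size s * c k| * A))).
  by apply: ler_wpM2r => //; rewrite mulr_ge0 ?cabs_ge0.
rewrite mul1r [leRHS]mulrAC; apply: ler_wpM2r; first exact: cabs_ge0.
rewrite ler_pdivlMr // normrM ger0_norm ?exprn_ge0 ?ler0n // mulrC mulrA -exprS.
apply: le_trans (natX_expR_sqrt R (size s) k).
by apply: ler_wpM2l; rewrite ?exprn_ge0 ?ler0n.
Unshelve. all: by end_near. Qed.

Lemma data_vanish_rescale_field (R : realType) (n : nat) (tau : R) (xi : R[i])
    (gamma : 'rV[R]_2) (W : 'cV[R[i]]_n) (i : 'I_n) :
  complex.Re xi <= 0 ->
  data_vanish [set x : 'rV[R]_3 | 0 < x 0 ax1]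
    (fun k z => rescale_field (field_mode tau xi gamma W) k z i 0).
Proof.
move=> xi0; apply: (@data_vanish_wave _ _ (growth_covector tau xi)
  (wave_covector xi gamma) _ (fun k => expR (- Num.sqrt k%:R)) (W i 0)).
- by move=> x /= x1; rewrite form_growth /= mulr0 add0r pmulr_lle0.
- by move=> k; rewrite ger0_norm ?expR_ge0.
- move=> k; apply/funext => z; rewrite rescale_field_mode field_modeE.
  by rewrite growth_covectorZ wave_covectorZ !mxE.
Qed.

Lemma data_vanish_rescale_front (R : realType) (tau : R) (gamma : 'rV[R]_2)
    (phib : R[i]) :
  data_vanish setT (rescale_front (front_mode tau gamma phib)).
Proof.
apply: (@data_vanish_wave _ _ (tau, 0) (0, gamma) _
  (fun k => expR (- Num.sqrt k%:R) / k%:R) phib).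
- move=> x _; rewrite /form /= mulr0 add0r big1 // => j _.
  by rewrite mxE mul0r.
- case=> [|k]; first by rewrite invr0 mulr0 normr0 expR_ge0.
  rewrite ger0_norm ?mulr_ge0 ?expR_ge0 ?invr_ge0 //.
  rewrite ler_pdivrMr ?ltr0n // ler_peMr ?expR_ge0 //.
  by rewrite ler1n.
- move=> k; apply/funext => y; rewrite rescale_front_mode front_modeE.
  by rewrite front_waveZ.
Qed.

(** At time [t] the modulus is [exp (k (tau t + Re xi x^1) - sqrt k)] times that of
    the amplitude. *)
Lemma rescale_field_blowup (R : realType) (n : nat) (tau : R) (xi : R[i])
    (gamma : 'rV[R]_2) (W : 'cV[R[i]]_n) (i : 'I_n) (t M : R) :
  0 < tau -> W i 0 != 0 -> 0 < t ->
  \forall k \near \oo%classic, exists2 x : 'rV[R]_3, 0 < x 0 ax1 &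
    M < cabs (rescale_field (field_mode tau xi gamma W) k (t, x) i 0).
Proof.
move=> tau0 W0 t0; have w0 := cabs_gt0 W0; set w := cabs _ in w0.
pose a := tau * t; have a0 : 0 < a by exact: mulr_gt0.
near=> k.
have k0 : 0 < (k%:R : R) by near: k; exact: nbhs_infty_gtr.
(* At depth 1 / k the decay in x^1 costs only the constant exp (Re xi). *)
exists (k%:R^-1 *: row_mx (1%:M : 'rV_1) (0 : 'rV_2)).
  rewrite mxE (_ : ax1 = lshift 2 (0 : 'I_1)); last exact: val_inj.
  by rewrite (@row_mxEl _ 1 1 2) mxE eqxx mulr1 invr_gt0.
rewrite rescale_field_mode field_modeE growth_covectorZ wave_covectorZ !mxE.
rewrite cabs_waveM cabs_realM ger0_norm ?expR_ge0 // -/w mulrA -expRD formZl.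
set x := _ *: _.
have -> : form (growth_covector tau xi) (t, x) = a + complex.Re xi / k%:R.
  rewrite form_growth /=; congr (_ + _ * _).
  rewrite /x1_of /= mxE (_ : ax1 = lshift 2 (0 : 'I_1)); last exact: val_inj.
  by rewrite (@row_mxEl _ 1 1 2) mxE eqxx mulr1.
rewrite -ltr_pdivrMr //.
apply: lt_le_trans (expR_ge1Dx _).
have -> : k%:R * (a + complex.Re xi / k%:R) = a * k%:R + complex.Re xi.
  by field; rewrite gt_eqF.
set q := Num.sqrt _.
have q2 : q ^+ 2 = k%:R by rewrite sqr_sqrtr // ltW.
(* The inequality of arithmetic and geometric means for a k and 1 / a. *)
have qle : q <= (a * k%:R + a^-1) / 2.
  have := sqr_ge0 (a * q - 1).
  have -> : (a * q - 1) ^+ 2 = a * (a * q ^+ 2 + a^-1 - 2 * q).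
    by field; rewrite gt_eqF.
  by rewrite q2 pmulr_rge0 //; lra.
have kbig : (M / w + (2 * a)^-1 - complex.Re xi) * 2 / a < k%:R.
  by near: k; exact: nbhs_infty_gtr.
move: kbig qle; rewrite ltr_pdivrMr // invfM.
set b := a^-1; set u := M / w; lra.
Unshelve. all: by end_near. Qed.

Lemma symbol_solution_hadamard (R : realType) (e : eos R) (kappa : R)
    (Uh : plasma R) (Vh : vacuum R) (tau : R) (xip xiv : R[i])
    (gamma : 'rV[R]_2) (U : plasma R[i]) (V : vacuum R[i]) (phi : R[i]) :
  0 < tau -> complex.Re xip <= 0 -> complex.Re xiv <= 0 -> V != 0 ->
  symbol_solution e kappa Uh Vh tau xip xiv gamma U V phi ->
  hadamard_sequence e kappa Uh Vh
    (rescale_field (field_mode tau xip gamma U))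
    (rescale_field (field_mode tau xiv gamma V))
    (rescale_front (front_mode tau gamma phi)).
Proof.
move=> tau0 xip0 xiv0 V0 sol; split.
- move=> k k0; rewrite !rescale_field_mode rescale_front_mode.
  apply: symbol_solution_solves_P; rewrite rmorphM fmorphV.
  by apply: symbol_solution_scale => //; rewrite pnatr_eq0 -lt0n.
- split=> [i|i|]; [exact: data_vanish_rescale_field
    |exact: data_vanish_rescale_field|exact: data_vanish_rescale_front].
- move=> t M t0; have [i Vi] : exists i, V i 0 != 0.
    apply/existsP; apply: contra_neqT V0 => /existsPn Vi.
    by apply/colP => i; rewrite mxE; apply/eqP; move: (Vi i); rewrite negbK.
  near=> k.
  have [x x0 xM] : exists2 x : 'rV[R]_3, 0 < x 0 ax1 &
      M < cabs (rescale_field (field_mode tau xiv gamma V) k (t, x) i 0).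
    by near: k; exact: rescale_field_blowup.
  by exists x => //; right; exists i.
Unshelve. all: by end_near. Qed.

(** * The plasma and vacuum symbols at an aligned state *)

Lemma tens3_basis (T : comPzRingType) (a b : T) (j k : 'I_3) :
  tens3 (a *: basis3 T j) (b *: basis3 T k) = (a * b) *: delta_mx j k.
Proof.
apply/matrixP => x y; rewrite !mxE !eqxx !andbT.
by case: (x == j); case: (y == k); rewrite /= ?(mulr1, mulr0, mul0r).
Qed.

Lemma dot3_basisl (T : pzRingType) (a : T) (j : 'I_3) (v : 'cV[T]_3) :
  dot3 (a *: basis3 T j) v = a * v j 0.
Proof.
rewrite /dot3 (bigD1 j) //= big1 ?addr0 => [|i /negbTE ij].
  by rewrite !mxE !eqxx mulr1.
by rewrite !mxE ij mulr0 mul0r.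
Qed.

Lemma basis3E (T : pzRingType) (j i : 'I_3) : basis3 T j i 0 = (i == j)%:R.
Proof. by rewrite mxE eqxx andbT. Qed.

Lemma cV3_ax3 (T : pzRingType) (v : 'cV[T]_3) :
  v ax1 0 = 0 -> v ax2 0 = 0 -> v = v ax3 0 *: basis3 T ax3.
Proof.
move=> v1 v2; apply/colP; case=> [[|[|[|//]]] ?]; rewrite mxE basis3E.
- by rewrite mulr0 -[RHS]v1; congr (v _ _); apply: val_inj.
- by rewrite mulr0 -[RHS]v2; congr (v _ _); apply: val_inj.
- by rewrite mulr1; congr (v _ _); apply: val_inj.
Qed.

Lemma Gam_gt0 (R : realType) (U : plasma R) : 0 < Gam U.
Proof.
rewrite sqrtr_gt0 ltr_pwDl //; apply: sumr_ge0 => i _.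
by rewrite -expr2 sqr_ge0.
Qed.

(** Blocks of the plasma matrices when the velocity and the magnetic field are
    parallel to the third axis, [v = w e_3] and [H = h e_3].  The coefficient [al]
    is the inertia transverse to the field. *)
Section AlignedState.
Variables (R : realType) (e : eos R) (U : plasma R) (w h : R).
Hypotheses (velE : vel U = w *: basis3 R ax3) (HE : H_of U = h *: basis3 R ax3).
Local Notation G := (Gam U).
Local Notation n := (rho e U * enthalpy e U).
Local Notation al := (n * G + h ^+ 2 / G).

Let Gn0 : G != 0. Proof. by rewrite gt_eqF // Gam_gt0. Qed.

Lemma aligned_u : u_of U = (G * w) *: basis3 R ax3.
Proof. by rewrite -scalerA -velE /vel scalerA divff ?scale1r. Qed.

(** The identity [|v|^2 = 1 - 1 / Gamma^2]. *)
Lemma aligned_Gam : w ^+ 2 = 1 - (G ^+ 2)^-1.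
Proof.
have g2 : G ^+ 2 = 1 + (G * w) ^+ 2.
  rewrite [LHS]sqr_sqrtr; last first.
    by rewrite addr_ge0 //; apply: sumr_ge0 => i _; rewrite -expr2 sqr_ge0.
  by rewrite aligned_u dot3_basisl mxE basis3E mulr1.
have -> : w ^+ 2 = (1 + (G * w) ^+ 2 - 1) / G ^+ 2 by field.
by rewrite -g2; field.
Qed.

Lemma aligned_dot_vH : dot3 (vel U) (H_of U) = w * h.
Proof. by rewrite velE HE dot3_basisl mxE basis3E mulr1. Qed.

Lemma aligned_dot_HH : dot3 (H_of U) (H_of U) = h ^+ 2.
Proof. by rewrite HE dot3_basisl mxE basis3E mulr1. Qed.

Lemma aligned_Bsq : Bsq U = h ^+ 2.
Proof.
rewrite /Bsq aligned_dot_vH aligned_dot_HH exprMn aligned_Gam; field.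
exact: Gn0.
Qed.

Lemma aligned_bvec : bvec U = (G * h) *: basis3 R ax3.
Proof.
rewrite /bvec velE HE aligned_u dot3_basisl mxE basis3E mulr1 !scalerA -scalerDl.
congr (_ *: _); have -> : G * w * h * w = G * h * w ^+ 2 by ring.
by rewrite aligned_Gam; field; exact: Gn0.
Qed.

Lemma aligned_calA :
  calA e U = al%:M - (al - n / G) *: delta_mx ax3 ax3.
Proof.
rewrite /calA /= aligned_dot_vH aligned_dot_HH aligned_Bsq velE HE !tens3_basis.
set d := delta_mx _ _.
rewrite scalerDr !scalerA -!scaleNr -!addrA -!(scalerDl d); congr (_ + _ *: _).
have -> : w * h / G * (w * h) + w * h / G * (h * w) = 2 * h ^+ 2 / G * w ^+ 2.
  by ring.
by rewrite -[w * w]expr2 aligned_Gam /GRing.scale /=; field; exact: Gn0.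
Qed.

Lemma aligned_calM : calM U = G^-1%:M + (G - G^-1) *: delta_mx ax3 ax3.
Proof.
rewrite /calM aligned_u tens3_basis scalerDr scalemx1 scalerA; congr (_ + _ *: _).
have -> : G * w * (G * w) = G ^+ 2 * w ^+ 2 by ring.
by rewrite aligned_Gam; field; exact: Gn0.
Qed.

Lemma aligned_calN (j : 'I_3) : vel U j 0 = 0 -> H_of U j 0 = 0 ->
  calN U j = h *: delta_mx ax3 j.
Proof.
move=> vj Hj; rewrite /calN /= vj Hj !mul0r scale0r subr0 aligned_bvec.
rewrite -[basis3 R j]scale1r tens3_basis scalerA raddf0 subr0.
by congr (_ *: _); field; exact: Gn0.
Qed.

Lemma aligned_calAj (j : 'I_3) : vel U j 0 = 0 -> H_of U j 0 = 0 ->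
  calAj e U j = 0.
Proof.
move=> vj Hj; rewrite /calAj /= vj Hj !mul0r !scale0r !add0r.
rewrite aligned_dot_vH aligned_Bsq velE HE -[basis3 R j]scale1r !tens3_basis.
rewrite !mulr1 !mul1r -!scalerDr !scalerA.
by apply/eqP; rewrite subr_eq0; apply/eqP; congr (_ *: _); ring.
Qed.
End AlignedState.

Lemma A0_mul (R : realType) (e : eos R) (U : plasma R) (p : 'M[R[i]]_1)
    (u H : 'cV[R[i]]_3) (s : 'M[R[i]]_1) :
  cmx (A0 e U) *m col_mx p (col_mx u (col_mx H s)) =
  col_mx ((Gam U / (rho e U * a2 e U))%:C *: p + (cmx (vel U))^T *m u)
    (col_mx (cmx (vel U) *m p + cmx (calA e U) *m u)
      (col_mx (cmx (calM U) *m H) s)).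
Proof.
rewrite /A0 /cmx !map_col_mx !map_row_mx !mul_col_mx !mul_row_col.
by rewrite !map_mx0 !mul0mx !addr0 !add0r !map_scalar_mx /= map_trmx
  !mul_scalar_mx scale1r.
Qed.

Lemma Aj_mul (R : realType) (e : eos R) (U : plasma R) (j : 'I_3)
    (p : 'M[R[i]]_1) (u H : 'cV[R[i]]_3) (s : 'M[R[i]]_1) :
  cmx (Aj e U j) *m col_mx p (col_mx u (col_mx H s)) =
  col_mx ((u_of U j 0 / (rho e U * a2 e U))%:C *: p + (basis3 R[i] j)^T *m u)
    (col_mx (basis3 R[i] j *m p + cmx (calAj e U j) *m u
             + (cmx (calN U j))^T *m H)
      (col_mx (cmx (calN U j) *m u + (vel U j 0)%:C *: (cmx (calM U) *m H))
         ((vel U j 0)%:C *: s))).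
Proof.
rewrite /Aj /cmx !map_col_mx !map_row_mx !mul_col_mx !mul_row_col.
rewrite !map_mx0 !mul0mx !addr0 !add0r !map_scalar_mx /= -!map_trmx.
rewrite !mul_scalar_mx map_mxZ -scalemxAl /basis3 map_delta_mx addrA //.
Qed.

Lemma cmx_Bj (R : realType) (j : 'I_3) : cmx (Bj R j) = Bj R[i] j.
Proof.
rewrite /cmx /Bj map_block_mx !map_mx0 map_mxN.
suff -> : map_mx (fun a : R => a%:C)
    (\matrix_(i, k) cross3 (basis3 R j) (basis3 R k) i 0)
  = \matrix_(i, k) cross3 (basis3 R[i] j) (basis3 R[i] k) i 0 by [].
apply/matrixP; case=> [[|[|[|//]]] ?] k; rewrite !mxE /= ?basis3E.
all: by rewrite rmorphB !rmorphM !rmorph_nat.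
Qed.

Lemma sum_ax (M : nmodType) (F : 'I_3 -> M) :
  \sum_(j < 3) F j = F ax1 + F ax2 + F ax3.
Proof.
rewrite !big_ord_recl big_ord0 addr0 addrA.
by congr (F _ + F _ + F _); exact: val_inj.
Qed.

Lemma subr_scalar0 (T : pzRingType) (n : nat) (A : 'M[T]_n) : A - 0%:M = A.
Proof. by rewrite raddf0 subr0. Qed.

Lemma vacuum_symbol_mul_aux (T : comPzRingType) (n : nat) (A B C : 'M[T]_n)
    (W : 'cV[T]_n) (a b c d : T) :
  (a *: 1%:M - b *: A + c *: B + d *: C) *m W
  = a *: W + (A *m (- b *: W) + B *m (c *: W) + C *m (d *: W)).
Proof.
by rewrite !mulmxDl mulNmx -!scalemxAl -!scalemxAr mul1mx scaleNr !addrA.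
Qed.

(** [d] lists the factors that stand for the derivatives of the physical vacuum
    fields: reflection of the vacuum region to [x^1 > 0] turns [xi] into [- xi]. *)
Lemma vacuum_symbol_mul (R : realType) (tau : R) (xi : R[i])
    (gamma : 'rV[R]_2) (V : vacuum R[i]) :
  let d (j : 'I_3) := [:: - xi; Complex 0 (gamma 0 0); Complex 0 (gamma 0 1)]`_j in
  vacuum_symbol 0 tau xi gamma *m V =
  tau%:C *: V + col_mx (curl3 (fun j => d j *: E_of V))
                     (- curl3 (fun j => d j *: cH_of V)).
Proof.
move=> d; have := Bj_curl (fun j => d j *: V).
have -> : (fun j => E_of (d j *: V)) = (fun j => d j *: E_of V).
  by apply/funext => j; apply/matrixP => i k; rewrite !mxE.
have -> : (fun j => cH_of (d j *: V)) = (fun j => d j *: cH_of V).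
  by apply/funext => j; apply/matrixP => i k; rewrite !mxE.
move=> <-.
rewrite /vacuum_symbol subr_scalar0 !cmx_Bj vacuum_symbol_mul_aux sum_ax.
by rewrite /d.
Qed.

(** The column vector [(a, b, c)]. *)
Definition vec3 (T : pzRingType) (a b c : T) : 'cV[T]_3 :=
  \col_(i < 3) [:: a; b; c]`_i.

Lemma cV3P (T : pzRingType) (a b : 'cV[T]_3) :
  a ax1 0 = b ax1 0 -> a ax2 0 = b ax2 0 -> a ax3 0 = b ax3 0 -> a = b.
Proof.
move=> h1 h2 h3; apply/colP; case=> [[|[|[|//]]] ?].
- by rewrite (_ : Ordinal _ = ax1) //; exact: val_inj.
- by rewrite (_ : Ordinal _ = ax2) //; exact: val_inj.
- by rewrite (_ : Ordinal _ = ax3) //; exact: val_inj.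
Qed.

Lemma delta_mx_mul3 (T : comPzRingType) (j k : 'I_3) (u : 'cV[T]_3) :
  delta_mx j k *m u = u k 0 *: basis3 T j.
Proof.
apply/colP => i; rewrite !mxE (bigD1 k) //= big1 ?addr0 => [|l /negbTE lk].
  by rewrite !mxE !eqxx andbT mulrC.
by rewrite mxE lk andbF mul0r.
Qed.

Lemma basis3_tr_mul (T : comPzRingType) (j : 'I_3) (u : 'cV[T]_3) :
  (basis3 T j)^T *m u = (u j 0)%:M.
Proof.
apply/matrixP => a b; rewrite !ord1 !mxE eqxx mulr1n (bigD1 j) //= big1 ?addr0.
  by rewrite !mxE !eqxx mul1r.
by move=> l /negbTE lj; rewrite !mxE lj mul0r.
Qed.

Lemma cmx_basis3 (R : realType) (a : R) (j : 'I_3) :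
  cmx (a *: basis3 R j) = a%:C *: basis3 R[i] j.
Proof. by rewrite /cmx map_mxZ /basis3 map_delta_mx. Qed.

Lemma mulmx_symbol3 (T : comPzRingType) (m : nat) (A B C D : 'M[T]_m)
    (W : 'cV[T]_m) (a b c : T) :
  (a *: A + b *: B + c *: C + 0 *: D) *m W
  = a *: (A *m W) + b *: (B *m W) + c *: (C *m W).
Proof. by rewrite scale0r addr0 !mulmxDl -!scalemxAl. Qed.

Section AlignedPlasma.
Variables (R : realType) (e : eos R) (Uh : plasma R) (w h : R).
Hypotheses (velE : vel Uh = w *: basis3 R ax3)
  (HE : H_of Uh = h *: basis3 R ax3).
Local Notation G := (Gam Uh).
Local Notation n := (rho e Uh * enthalpy e Uh).
Local Notation al := (n * G + h ^+ 2 / G).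
Local Notation g := (G / (rho e Uh * a2 e Uh)).

Let Gn0 : G != 0. Proof. by rewrite gt_eqF // Gam_gt0. Qed.

Lemma aligned_A0_mul (p : R[i]) (u H : 'cV[R[i]]_3) :
  cmx (A0 e Uh) *m col_mx p%:M (col_mx u (col_mx H 0)) =
  col_mx (g%:C * p + w%:C * u ax3 0)%:M
    (col_mx (al%:C *: u
             + (w%:C * p - (al - n / G)%:C * u ax3 0) *: basis3 R[i] ax3)
      (col_mx (G^-1%:C *: H + ((G - G^-1)%:C * H ax3 0) *: basis3 R[i] ax3) 0)).
Proof.
rewrite A0_mul velE cmx_basis3 (aligned_calA e velE HE) (aligned_calM velE).
rewrite linearZ /= -scalemxAl basis3_tr_mul mul_mx_scalar.
rewrite /cmx map_mxB map_mxD !map_scalar_mx !map_mxZ !map_delta_mx /=.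
rewrite mulmxBl mulmxDl !mul_scalar_mx -!scalemxAl !delta_mx_mul3 !scalerA.
congr col_mx; last congr col_mx.
  by rewrite !scale_scalar_mx -raddfD.
rewrite addrCA -scalerBl; congr (_ + _ *: _); by rewrite mulrC.
Qed.

Lemma aligned_Aj_mul (j : 'I_3) (p : R[i]) (u H : 'cV[R[i]]_3) :
  vel Uh j 0 = 0 -> H_of Uh j 0 = 0 ->
  cmx (Aj e Uh j) *m col_mx p%:M (col_mx u (col_mx H 0)) =
  col_mx (u j 0)%:M
    (col_mx ((p + h%:C * H ax3 0) *: basis3 R[i] j)
      (col_mx ((h%:C * u j 0) *: basis3 R[i] ax3) 0)).
Proof.
move=> vj Hj; have uj : u_of Uh j 0 = 0.
  have : u_of Uh = G *: vel Uh by rewrite scalerA divff ?scale1r.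
  by move=> ->; rewrite mxE vj mulr0.
rewrite Aj_mul uj vj (aligned_calN velE HE vj Hj) (aligned_calAj e velE HE vj Hj).
rewrite mul0r !scale0r add0r !addr0 basis3_tr_mul mul_mx_scalar /cmx map_mx0.
rewrite mul0mx addr0 map_mxZ map_delta_mx linearZ /= trmx_delta.
by rewrite -!scalemxAl !delta_mx_mul3 !scalerA -scalerDl.
Qed.

Lemma aligned_dq (U : plasma R[i]) :
  dq Uh U = p_of U + h%:C * H_of U ax3 0.
Proof.
rewrite /dq (aligned_bvec velE HE) (aligned_dot_vH velE HE) (aligned_Bsq velE HE).
rewrite velE HE !cmx_basis3 !dot3_basisl; congr (_ + _).
have Gc : G%:C != 0 :> R[i] by rewrite fmorph_eq0.
by rewrite !rmorphM fmorphV /=; field.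
Qed.

Lemma aligned_dvel1 (U : plasma R[i]) :
  dvel Uh U ax1 0 = (G^-1)%:C * u_of U ax1 0.
Proof.
rewrite /dvel velE cmx_basis3 mxE; congr (_ * _).
rewrite [LHS]mxE [X in _ + X]mxE [X in - X]mxE [X in _ * X]mxE basis3E.
by rewrite !mulr0 oppr0 addr0.
Qed.

(** The interior plasma equations for [gamma' = (1, 0)], row by row; the rows of the
    first two magnetic components and of the entropy hold since these components
    are taken to be 0. *)
Lemma aligned_plasma_symbol (tau : R) (xi p u1 u2 u3 h3 : R[i]) :
  tau%:C * (g%:C * p + w%:C * u3) + xi * u1 + Complex 0 1 * u2 = 0 ->
  tau%:C * al%:C * u1 + xi * (p + h%:C * h3) = 0 ->
  tau%:C * al%:C * u2 + Complex 0 1 * (p + h%:C * h3) = 0 ->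
  w%:C * p + (n / G)%:C * u3 = 0 ->
  tau%:C * G%:C * h3 + h%:C * (xi * u1 + Complex 0 1 * u2) = 0 ->
  plasma_symbol e 0 Uh tau xi (delta_mx 0 0)
    *m col_mx p%:M (col_mx (vec3 u1 u2 u3) (col_mx (vec3 0 0 h3) 0)) = 0.
Proof.
move=> E1 E2 E3 E4 E5.
have v1 : vel Uh ax1 0 = 0 by rewrite velE mxE basis3E mulr0.
have v2 : vel Uh ax2 0 = 0 by rewrite velE mxE basis3E mulr0.
have H1 : H_of Uh ax1 0 = 0 by rewrite HE mxE basis3E mulr0.
have H2 : H_of Uh ax2 0 = 0 by rewrite HE mxE basis3E mulr0.
rewrite /plasma_symbol !mxE /= mulmx_symbol3 scale0r subr0.
rewrite aligned_A0_mul !aligned_Aj_mul // !scale_col_mx !add_col_mx !scaler0 !addr0.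
rewrite -[RHS]col_mx0 -[X in _ = col_mx _ X]col_mx0.
rewrite -[X in _ = col_mx _ (col_mx _ X)]col_mx0 !mxE /=.
congr col_mx; last congr col_mx; last congr col_mx.
- by rewrite !scale_scalar_mx -!raddfD /= E1 raddf0.
- apply: cV3P; rewrite !mxE /= ?(mulr0, mulr1, addr0, add0r).
  + by rewrite -E2; ring.
  + by rewrite -E3; ring.
  + rewrite rmorphB /=.
    transitivity (tau%:C * (w%:C * p + (n / G)%:C * u3)); first by ring.
    by rewrite E4 mulr0.
- apply: cV3P; rewrite !mxE /= ?(mulr0, mulr1, addr0, add0r) //.
  by rewrite rmorphB /= -E5; ring.
Qed.
End AlignedPlasma.

(** * The dispersion relation and the unstable mode *)

(** The root lies between 0 and the zero [T] of [E2 - h2 (1 + t^2)], where the two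
    sides compare in opposite ways. *)
Lemma dispersion_root (R : realType) (a K E2 h2 : R) :
  0 < a -> 0 < K -> 0 < h2 -> h2 < E2 ->
  exists2 t : R, 0 < t &
    t ^+ 2 * a / Num.sqrt (1 + K * t ^+ 2)
    = E2 / Num.sqrt (1 + t ^+ 2) - h2 * Num.sqrt (1 + t ^+ 2).
Proof.
move=> a0 K0 h0 hE.
pose s (t : R) := Num.sqrt (1 + t ^+ 2).
pose r (t : R) := Num.sqrt (1 + K * t ^+ 2).
have sp (t : R) : 0 < 1 + t ^+ 2 by apply: ltr_pwDl => //; exact: sqr_ge0.
have rp (t : R) : 0 < 1 + K * t ^+ 2.
  by apply: ltr_pwDl => //; rewrite mulr_ge0 ?sqr_ge0 // ltW.
have s0 (t : R) : 0 < s t by rewrite sqrtr_gt0.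
have r0 (t : R) : 0 < r t by rewrite sqrtr_gt0.
(* The relation, cleared of denominators. *)
pose f (t : R) := t ^+ 2 * a * s t - (E2 - h2 * (1 + t ^+ 2)) * r t.
pose T := Num.sqrt ((E2 - h2) / h2).
have T2 : T ^+ 2 = (E2 - h2) / h2.
  by rewrite sqr_sqrtr // divr_ge0 ?subr_ge0 // ltW.
have f0 : f 0 < 0.
  rewrite /f /r expr0n /= !mul0r sub0r oppr_lt0 mulr0 addr0 sqrtr1 !mulr1.
  by rewrite subr_gt0.
have fT : 0 < f T.
  rewrite /f (_ : E2 - _ = 0); last by rewrite T2; field; rewrite gt_eqF.
  by rewrite mul0r subr0 mulr_gt0 // mulr_gt0 // T2 divr_gt0 ?subr_gt0.
have csq (c : R) : continuous (fun t : R => c * t ^+ 2).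
  by move=> t; apply: cvgMr; exact: exprn_continuous.
have fc : continuous f.
  move=> t; apply: cvgB; apply: cvgM.
  - apply: cvgMl; exact: exprn_continuous.
  - apply: continuous_comp; last exact: sqrt_continuous.
    apply: cvgD; [exact: cvg_cst|exact: exprn_continuous].
  - apply: cvgB; first exact: cvg_cst.
    apply: cvgMr; apply: cvgD; [exact: cvg_cst|exact: exprn_continuous].
  - apply: continuous_comp; last exact: sqrt_continuous.
    apply: cvgD; [exact: cvg_cst|exact: csq].
have T0 : 0 <= T by exact: sqrtr_ge0.
have [||t /andP[t0 tT] ft] := @IVT _ f 0 T 0 T0.
- exact: continuous_subspaceT.
- by rewrite ge_min le_max (ltW f0) (ltW fT) orbT.
have tp : 0 < t.
  rewrite lt_neqAle; move: t0; rewrite bnd_simp => ->; rewrite andbT.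
  apply: contraTneq f0 => /esym t_0.
  by move: ft; rewrite t_0 => ->; rewrite ltxx.
exists t => //; rewrite -/(s t) -/(r t).
have s2 : s t ^+ 2 = 1 + t ^+ 2 by rewrite sqr_sqrtr // ltW.
have e : t ^+ 2 * a * s t = (E2 - h2 * s t ^+ 2) * r t.
  by apply/eqP; rewrite -subr_eq0 s2; apply/eqP.
have -> : t ^+ 2 * a / r t = t ^+ 2 * a * s t / (s t * r t).
  by field; rewrite !gt_eqF.
by rewrite e; field; rewrite !gt_eqF.
Qed.

(** Explicit amplitudes, normalized by [phi = 1].  The total pressure at the
    interface is [q = p + h H_3]; eliminating [u_3] gives [div u = - tau m p],
    and eliminating [H_3] gives [q = L p].  The hypothesis on [r] is the
    characteristic equation of the plasma, the one on [q] the balance of total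
    pressure. *)
Lemma aligned_symbol_solution (R : realType) (e : eos R) (Uh : plasma R)
    (Vh : vacuum R) (w h tau r s : R) :
  let G := Gam Uh in
  let n := rho e Uh * enthalpy e Uh in
  let al := n * G + h ^+ 2 / G in
  let m := G / (rho e Uh * a2 e Uh) - G * w ^+ 2 / n in
  let L := 1 + h ^+ 2 * m / G in
  let E1 := E_of Vh ax1 0 in
  let h2 := cH_of Vh ax2 0 in
  let q := tau ^+ 2 * (al * G) / r in
  let p := q / L in
  vel Uh = w *: basis3 R ax3 -> H_of Uh = h *: basis3 R ax3 ->
  cH_of Vh ax3 0 = 0 ->
  n != 0 -> al != 0 -> L != 0 -> r != 0 -> s != 0 ->
  s ^+ 2 = 1 + tau ^+ 2 ->
  r ^+ 2 = 1 + al * m / L * tau ^+ 2 ->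
  q = E1 ^+ 2 / s - h2 ^+ 2 * s ->
  symbol_solution e 0 Uh Vh tau (- r)%:C (- s)%:C (delta_mx 0 0)
    (col_mx (p%:C)%:M
      (col_mx (vec3 (tau * G)%:C (Complex 0 (- (tau * G / r)))
                    (- (G * w * p / n))%:C)
        (col_mx (vec3 0 0 (h * m * p / G)%:C) 0)))
    (col_mx (vec3 (Complex 0 h2) (- (h2 * s))%:C (Complex 0 (tau * E1 / s)))
            (vec3 (- (E1 / s))%:C (Complex 0 (- E1)) (- (h2 * tau))%:C))
    1.
Proof.
move=> G n al m L E1 h2 q p velE HE cH3 n0 al0 L0 r0 s0 s2 r2 disp.
have G0 : G != 0 by rewrite gt_eqF // Gam_gt0.
(* [pL]: total pressure; [mp]: the divergence of the velocity. *)
have pL : p + h * (h * m * p / G) = q.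
  by rewrite -[RHS](divfK L0) -/p /L; field.
have qr : tau * al * (tau * G) = r * q by rewrite /q; field.
have mp : tau * (m * p) = tau * G * r - tau * G / r.
  transitivity (tau * G / r * (al * m / L * tau ^+ 2)).
    by rewrite /p /q; field; rewrite ?n0 ?G0 ?r0 ?L0.
  have -> : al * m / L * tau ^+ 2 = r ^+ 2 - 1 by rewrite r2; ring.
  by field.
have div1 : tau * (G / (rho e Uh * a2 e Uh) * p + w * - (G * w * p / n))
    - r * (tau * G) + tau * G / r = 0.
  rewrite (_ : _ * p + _ = m * p); last by rewrite /m; ring.
  by rewrite mp; ring.
split.
- apply: (aligned_plasma_symbol velE HE); rewrite -/G -/n -/al; apply/eqP;
    rewrite eq_complex /=; apply/andP; split; apply/eqP; try by ring.
  + by rewrite -[RHS]div1; ring.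
  + transitivity (tau * al * (tau * G) - r * (p + h * (h * m * p / G))).
      by ring.
    by rewrite pL qr subrr.
  + transitivity (p + h * (h * m * p / G) - tau * al * (tau * G) / r).
      by ring.
    by rewrite pL qr; field.
  + by field; rewrite ?n0 ?G0 ?r0 ?L0.
  + transitivity (h * (tau * (m * p) - r * (tau * G) + tau * G / r)).
      by field; rewrite ?n0 ?G0 ?r0 ?L0.
    by rewrite mp; ring.
- rewrite vacuum_symbol_mul /cH_of /E_of col_mxKu col_mxKd.
  rewrite scale_col_mx add_col_mx -[RHS]col_mx0.
  congr col_mx; apply: cV3P; rewrite !mxE /= ?mxE /=; apply/eqP;
    rewrite eq_complex /=; apply/andP; split; apply/eqP; try by ring.
  + transitivity (E1 / s * (tau ^+ 2 + 1 - s ^+ 2)); first by field.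
    by rewrite s2; ring.
  + by field.
  + transitivity (h2 * (s ^+ 2 - 1 - tau ^+ 2)); first by ring.
    by rewrite s2; ring.
- rewrite /boundary_symbol (aligned_dvel1 velE) (aligned_dq velE HE) cH3.
  have -> : vel Uh ax2 0 = 0 by rewrite velE mxE basis3E mulr0.
  rewrite /p_of /u_of /H_of /cH_of /E_of !col_mxKu !col_mxKd !col_mxKu.
  rewrite -/(E_of Vh) -/(cH_of Vh) -/E1 -/h2 !mxE /=.
  split; apply/eqP; rewrite eq_complex /=; apply/andP; split; apply/eqP;
    try by ring.
  + by rewrite -/G; field.
  + transitivity q; first by rewrite -pL; ring.
    by rewrite disp; field.
Qed.

Local Close Scope complex_scope.

Theorem mainTheorem2 (R : realType) (e : eos R) (kappa : R)
    (Uh : plasma R) (Vh : vacuum R)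
    (Uh_hyperbolic : hyperbolic e Uh)
    (state_planar : planar_state kappa Uh Vh)
    (kappa0 : kappa = 0)
    (v1 : vel Uh ax1 0 = 0) (v2 : vel Uh ax2 0 = 0)
    (H1 : H_of Uh ax1 0 = 0) (H2 : H_of Uh ax2 0 = 0)
    (cH1 : cH_of Vh ax1 0 = 0) (cH3 : cH_of Vh ax3 0 = 0)
    (E2 : E_of Vh ax2 0 = 0) (E3 : E_of Vh ax3 0 = 0)
    (H3cH2 : H_of Uh ax3 0 * cH_of Vh ax2 0 != 0)
    (E1_large : E_of Vh ax1 0 ^+ 2 > cH_of Vh ax2 0 ^+ 2) :
  exists (tau : R) (xip xiv : R[i]) (Ub : plasma R[i]) (Vb : vacuum R[i])
         (phib : R[i]),
    let gamma : 'rV[R]_2 := delta_mx 0 0 in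
    let U := field_mode tau xip gamma Ub in
    let V := field_mode tau xiv gamma Vb in
    let phi := front_mode tau gamma phib in
    [/\ 0 < tau, complex.Re xip < 0 /\ complex.Re xiv < 0,
        (Ub, Vb) <> (0, 0),
        solves_P e kappa Uh Vh (fun=> 0) U V phi
      & hadamard_sequence e kappa Uh Vh
          (rescale_field U) (rescale_field V) (rescale_front phi)].
Proof.
have velE := cV3_ax3 v1 v2; have HE := cV3_ax3 H1 H2.
set w := vel Uh ax3 0 in velE; set h := H_of Uh ax3 0 in HE H3cH2.
move: H3cH2 E1_large; set h2 := cH_of Vh ax2 0; set E1 := E_of Vh ax1 0.
rewrite mulf_eq0 negb_or => /andP[h0 h20] E1_large.
set G := Gam Uh; have G0 : 0 < G by exact: Gam_gt0.
have [_ rho0 rhop0 /andP[cs0 cs1]] := Uh_hyperbolic.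
have a20 : 0 < a2 e Uh by rewrite divr_gt0.
have enth0 : 0 < enthalpy e Uh by move: cs0; rewrite /cs2 pmulr_rgt0 // invr_gt0.
pose n := rho e Uh * enthalpy e Uh; have n0 : 0 < n by exact: mulr_gt0.
pose al := n * G + h ^+ 2 / G.
have al0 : 0 < al.
  by apply: ltr_pwDl; [exact: mulr_gt0|rewrite divr_ge0 ?sqr_ge0 // ltW].
pose m := G / (rho e Uh * a2 e Uh) - G * w ^+ 2 / n.
have m0 : 0 < m.
  (* The sound speed and the flow speed are both below 1. *)
  have -> : m = G / n * ((cs2 e Uh)^-1 - w ^+ 2).
    by rewrite /m /n /cs2; field; rewrite !gt_eqF.
  rewrite mulr_gt0 ?divr_gt0 // subr_gt0; apply: (@lt_trans _ _ 1).
    by rewrite (aligned_Gam velE) gtrBl invr_gt0 exprn_gt0.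
  by rewrite invf_gt1.
pose L := 1 + h ^+ 2 * m / G.
have L0 : 0 < L.
  by apply: ltr_pwDl => //; rewrite divr_ge0 ?(ltW G0) // mulr_ge0 ?sqr_ge0 // ltW.
have K0 : 0 < al * m / L by rewrite divr_gt0 // mulr_gt0.
have alG0 : 0 < al * G by exact: mulr_gt0.
have h22 : 0 < h2 ^+ 2 by rewrite exprn_even_gt0.
have [tau tau0 disp] := dispersion_root alG0 K0 h22 E1_large.
pose s := Num.sqrt (1 + tau ^+ 2); pose r := Num.sqrt (1 + al * m / L * tau ^+ 2).
have sp : 0 < 1 + tau ^+ 2 by apply: ltr_pwDl => //; exact: sqr_ge0.
have rp : 0 < 1 + al * m / L * tau ^+ 2.
  by apply: ltr_pwDl => //; rewrite mulr_ge0 ?sqr_ge0 // ltW.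
have s0 : 0 < s by rewrite sqrtr_gt0.
have r0 : 0 < r by rewrite sqrtr_gt0.
have sol := @aligned_symbol_solution R e Uh Vh w h tau r s velE HE cH3
  (lt0r_neq0 n0) (lt0r_neq0 al0) (lt0r_neq0 L0) (lt0r_neq0 r0) (lt0r_neq0 s0)
  (sqr_sqrtr (ltW sp)) (sqr_sqrtr (ltW rp)) disp.
move: sol; rewrite /= -/h2 -/E1 -/G.
set Ub := col_mx (_%:M) _; set Vb := col_mx (vec3 _ _ _) _ => sol.
have Vb0 : Vb != 0.
  apply/eqP => V0; have := congr1 (fun V : vacuum R[i] => cH_of V ax2 0) V0.
  rewrite /cH_of col_mxKu !mxE /= => -[]/eqP.
  by rewrite oppr_eq0 mulf_eq0 (negbTE h20) gt_eqF.
exists tau, (- r)%:C%C, (- s)%:C%C, Ub, Vb, 1; rewrite kappa0.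
split => //.
- by rewrite /= !oppr_lt0.
- by case=> _ V0; move: Vb0; rewrite V0 eqxx.
- exact: symbol_solution_solves_P.
- by apply: symbol_solution_hadamard sol => //=; rewrite oppr_le0 ltW.
Qed.
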